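(* In the permutation model for random binary search trees, the following hold as $n\to\infty$. (a) Let $k=k(n)\in\{1,\dots,n\}$ be a sequence with $k=\omega(n/\sqrt{\log n})$, i.e. $k\sqrt{\log n}/n\to\infty$. Then $$\mathbf{E}\big[|W_k(n)-kD_k(n)|\big]=o\big(\sigma_{kD_k(n)}\big).$$ (b) In particular, for $0<\alpha<1$ and $k=k(n)$ with $|k/n-\alpha|=o((\log n)^{-1/2})$, in distribution, $$\left(\frac{D_k(n)-2\log n}{\sqrt{2\log n}},\ \frac{W_k(n)-2\alpha n\log n}{\alpha n\sqrt{2\log n}}\right)\to(\mathcal N,\mathcal N),$$ where $\mathcal N$ is a standard normal random variable (the same random variable in both coordinates). (c) For the last inserted node, in distribution, $$\left(\frac{X_n-2\log n}{\sqrt{2\log n}},\ \frac{\mathbb X_n}{2n\log n}\right)\to(\mathcal N,\xi),$$ where $\mathcal N$ and $\xi$ are independent, $\mathcal N$ is standard normal and $\xi$ is uniformly distributed on $[0,1]$.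
   Context: Binary search tree: given a list of distinct elements of a totally ordered set, the binary search tree is the labelled rooted binary tree with one node per element, obtained by successively inserting the elements in the order of the list, so that for every node with label (key) $y$ all keys in its left subtree are at most $y$ and all keys in its right subtree are strictly larger than $y$. Permutation model: the list is a uniformly random permutation of $\{1,\dots,n\}$. Notation: $D_k(n)$ is the depth (graph distance to the root) of the node labelled $k$, for $1\le k\le n$. $W_k(n)$ is its weighted depth, i.e. the sum of all labels on the path from the root to the node labelled $k$, labels of both endpoints included. $X_n$ is the depth and $\mathbb X_n$ the weighted depth (sum of labels on the path from the root, both endpoints included) of the $n$th (last) inserted node. For a real random variable $X$ with finite second moment, $\sigma_X$ denotes its standard deviation. *)

(* Defs.v *)
From HB Require Import structures.
From mathcomp Require Import all_boot all_order all_algebra all_fingroup.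
From mathcomp Require Import finmap.
From mathcomp Require Import all_classical all_reals all_analysis.

Set Implicit Arguments.
Unset Strict Implicit.
Unset Printing Implicit Defensive.

Import Order.TTheory GRing.Theory Num.Theory.
Import numFieldNormedType.Exports.

Local Open Scope classical_set_scope.
Local Open Scope ring_scope.

Inductive bintree (T : Type) : Type :=
| Leaf
| Node of bintree T & T & bintree T.

Arguments Leaf {T}.

Section BinarySearchTree.
Context {disp : Order.disp_t} {T : orderType disp}.

Fixpoint bst_insert (t : bintree T) (x : T) : bintree T :=
  match t with
  | Leaf => Node Leaf x Leaf
  | Node l y r => if (x <= y)%O then Node (bst_insert l x) y r
                  else Node l y (bst_insert r x)
  end.

Definition bst (s : seq T) : bintree T := foldl bst_insert Leaf s.

Fixpoint labels (t : bintree T) : seq T :=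
  match t with
  | Leaf => [::]
  | Node l y r => labels l ++ y :: labels r
  end.

(* Labels on the path from the root to the node labelled x, endpoints
   included. It is defined for any tree with distinct labels, without using
   the search property; it is empty if x is not a label. *)
Fixpoint root_path (x : T) (t : bintree T) : seq T :=
  match t with
  | Leaf => [::]
  | Node l y r =>
      if x == y then [:: y]
      else if x \in labels l then y :: root_path x l
      else if x \in labels r then y :: root_path x r
      else [::]
  end.

(* Number of edges, hence the predecessor. *)
Definition depth (x : T) (t : bintree T) : nat := (size (root_path x t)).-1.

End BinarySearchTree.

Definition wdepth (x : nat) (t : bintree nat) : nat :=
  (\sum_(y <- root_path x t) y)%N.

(* {perm T} unfolds to perm_type T, which carries the library instances. *)
HB.instance Definition _ (T : finType) :=
  isPointed.Build (perm_type T) (perm_one T).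
HB.instance Definition _ (T : finType) :=
  @isMeasurable.Build default_measure_display (perm_type T)
    discrete_measurable discrete_measurable0
    discrete_measurableC discrete_measurableU.

Section PermutationModel.
Variable n : nat.

(* The i-th inserted key (i = 0, ..., n - 1) is s i + 1, as 'I_n starts at 0. *)
Definition perm_keys (s : 'S_n) : seq nat := [seq (s i).+1 | i <- enum 'I_n].

Definition perm_bst (s : 'S_n) : bintree nat := bst (perm_keys s).

Definition last_key (s : 'S_n) : nat := last 0%N (perm_keys s).

Variable R : realType.

Definition uniform_perm : set 'S_n -> \bar R :=
  mscale (n`!%:R^-1)%:nng (@counting 'S_n R).

HB.instance Definition _ := Measure.on uniform_perm.

Lemma uniform_perm_setT : uniform_perm [set: 'S_n] = 1%E.
Proof.
rewrite /uniform_perm /mscale /= /counting.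
rewrite asboolT; last exact: finite_finset.
have -> : [set: 'S_n] = [set` [fset x in enum [set: 'S_n]%SET]%fset].
  by apply/seteqP; split => // x _; rewrite /= inE mem_enum inE.
rewrite set_fsetK card_fseq undup_id ?enum_uniq // -cardE cardsT card_Sn.
by rewrite -EFinM mulVf.
Qed.

HB.instance Definition _ :=
  Measure_isProbability.Build _ _ _ uniform_perm uniform_perm_setT.

Definition node_depth (k : nat) (s : 'S_n) : R := (depth k (perm_bst s))%:R.

Definition node_wdepth (k : nat) (s : 'S_n) : R := (wdepth k (perm_bst s))%:R.

Definition last_depth (s : 'S_n) : R := (depth (last_key s) (perm_bst s))%:R.

Definition last_wdepth (s : 'S_n) : R := (wdepth (last_key s) (perm_bst s))%:R.

End PermutationModel.

Arguments uniform_perm n R : clear implicits.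
Arguments node_depth {n R}.
Arguments node_wdepth {n R}.
Arguments last_depth {n R}.
Arguments last_wdepth {n R}.

Section Probability.
Context {R : realType}.

Definition stddev d (T : measurableType d) (P : probability T R)
  (Y : T -> R) : R := Num.sqrt (fine 'V_P[Y]).

(* Equality is required on measurable sets only: the values of a measure
   elsewhere are unspecified. *)
Definition has_law d d' (T : measurableType d) (E : measurableType d')
  (P : probability T R) (Y : {RV P >-> E}) (mu : set E -> \bar R) : Prop :=
  forall A, measurable A -> distribution P Y A = mu A.

Definition independent_RV d d1 d2 (T : measurableType d)
  (E1 : measurableType d1) (E2 : measurableType d2) (P : probability T R)
  (Y : {RV P >-> E1}) (Z : {RV P >-> E2}) : Prop :=
  forall A B, measurable A -> measurable B ->
    P (Y @^-1` A `&` Z @^-1` B) = (P (Y @^-1` A) * P (Z @^-1` B))%E.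

(* The sequence and the limit may live on different probability spaces. *)
Definition cvg_in_distribution (E : topologicalType)
  (d_ : nat -> measure_display) (T_ : forall n, measurableType (d_ n))
  (P_ : forall n, probability (T_ n) R) (Y_ : forall n, T_ n -> E)
  (d : measure_display) (T : measurableType d) (P : probability T R)
  (Y : T -> E) : Prop :=
  forall f : E -> R, continuous f -> bounded_fun f ->
    ('E_(P_ n)[f \o Y_ n] @[n --> \oo] --> 'E_P[f \o Y])%E.

End Probability.

(* Main.v *)
Require Import Defs.
From HB Require Import structures.
From mathcomp Require Import all_boot all_order all_algebra all_fingroup.
From mathcomp Require Import ring lra zify finmap.
From mathcomp Require Import all_classical all_reals all_analysis.
From mathcomp Require Import measurable_realfun.

Set Implicit Arguments.
Unset Strict Implicit.
Unset Printing Implicit Defensive.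

Import Order.TTheory GRing.Theory Num.Theory.
Import numFieldNormedType.Exports.

(** Let 1 <= k <= n, and insert the keys 1, ..., n in a uniformly random order.
    A key j is an ancestor of k exactly when j is inserted before all the other
    keys between j and k ([root_path_bst]), so a key at distance i from k is an
    ancestor with probability 1/(i+1).

    (a) Hence W_k - k D_k, the sum of k and of the differences j - k over the
    proper ancestors j of k, has absolute mean at most 2n ([avg_wdepth_sub]).
    The ancestors of k on its left are the records of a random ordering, which
    are independent events, and so are those on its right; a left and a right
    ancestor are positively correlated. The variance of D_k is thus at least
    the sum of the variances of the two sides, of the order of log n
    ([variance_depth_ge]), and 2n is negligible with respect to k sqrt(log n).

    (b) Moving k to the end of the list adds at most 2 ancestors on average
    ([avg_late_depth_sub]). When k comes last, the orders of the smaller and of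
    the larger keys are independent, so its depth is a sum of independent
    Bernoulli variables of parameters 1/i, for 1 <= i < k and for
    1 <= i <= n - k ([avg_late_depth_rem]). Mean and variance are equal to
    2 log n up to a bounded term when k/n stays away from 0 and 1. Stein's
    method gives the normal approximation of such a sum, with an error of the
    order of the inverse of the standard deviation for bounded Lipschitz test
    functions ([bern_gauss]): the solution f of f'(x) - x f(x) = h(x) - E h(N)
    is bounded and has a bounded derivative ([stein_solution]), and
    E[S g(S)] is explicit for a centred sum S ([bern_stein]). By (a), W_k can
    be replaced by k D_k.

    (c) The last key is uniform, and given that it is k, its depth is the sum
    above. The errors of the normal approximation are averaged over k, using
    that the mean of the sum, averaged over k, is 2 log n up to a bounded term
    ([avg_bmean_depth]). The weighted depth is close to k times 2 log n, and
    the average over k of the expectations of h(N, k/n) is close to the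
    expectation of h(N, xi) ([grid_approx]).

    Bounded Lipschitz test functions suffice: a bounded continuous function is
    the increasing limit of its inf-convolutions ([portmanteau]). *)

Local Open Scope ring_scope.

Local Notation filter := seq.filter.

(** * Ancestors in a binary search tree *)

Section BinarySearchTrees.
Implicit Types (k y z : nat) (l s t : seq nat).

(** The keys lying between [j] and [k], both included. *)
Definition between (j k : nat) : pred nat :=
  fun z => (minn j k <= z <= maxn j k)%N.

(** [first P j s] says that [j] is the first element of [s] satisfying [P]. *)
Definition first (T : eqType) (P : pred T) (j : T) (s : seq T) : bool :=
  ohead (filter P s) == Some j.

Lemma bst_foldl_Node y t (l r : bintree nat) :
  foldl bst_insert (Node l y r) t =
  Node (foldl bst_insert l [seq z <- t | (z <= y)%N]) y
       (foldl bst_insert r [seq z <- t | (y < z)%N]).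
Proof.
elim: t l r => //= z t IH l r; rewrite leEnat ltnNge.
by case: ifP => _; rewrite IH.
Qed.

Lemma bst_cons y t :
  bst (y :: t) = Node (bst [seq z <- t | (z <= y)%N]) y
                      (bst [seq z <- t | (y < z)%N]).
Proof. by rewrite /bst /= bst_foldl_Node. Qed.

Lemma mem_labels_bst l : labels (bst l) =i l.
Proof.
move: {2}(size l) (leqnn (size l)) => m; elim: m l => [|m IH] [|y t] //= lem.
move=> z; rewrite bst_cons /= mem_cat !in_cons.
rewrite !IH ?size_filter ?(leq_trans (count_size _ _)) //.
rewrite !mem_filter; case: eqP => [->|_] /=; first by rewrite orbT.
by case: ltnP; rewrite ?orbF.
Qed.

(** The nodes on the path to [k] are the keys [j] that are inserted before all
    the other keys between [j] and [k]. *)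
Lemma root_path_bst k l : uniq l -> k \in l ->
  root_path k (bst l) = [seq j <- l | first (between j k) j l].
Proof.
move: {2}(size l) (leqnn (size l)) => m; elim: m l => [|m IH] [|y t] //= lem.
case/andP=> yt ut; rewrite in_cons bst_cons /= !mem_labels_bst !mem_filter.
have first_y : first (between y k) y (y :: t).
  by rewrite /first /= /between geq_minl leq_maxl /=.
rewrite first_y.
(* [Q] is the side of the root [y] where [k] lies: on that side the root is
   not between [j] and [k]; for [j] on the other side the root comes first. *)
have side (Q : pred nat) : Q k -> k \in t ->
  (forall j, j \in t -> Q j -> forall z, z \in y :: t -> between j k z ->
     (z != y) && Q z) ->
  (forall j, j \in t -> ~~ Q j -> between j k y) ->
  root_path k (bst [seq z <- t | Q z]) =
    [seq j <- t | first (between j k) j (y :: t)].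
  move=> Qk kt H1 H2; rewrite IH ?filter_uniq ?mem_filter ?Qk //; last first.
    by rewrite size_filter (leq_trans (count_size _ _)).
  rewrite -filter_predI; apply: eq_in_filter => j jt /=.
  have [Qj|nQj] := boolP (Q j); last first.
    rewrite andbF /first /= H2 //; apply/esym/negbTE/eqP => -[yj].
    by rewrite yj jt in yt.
  rewrite andbT /first /=; case: ifP => [bjy|_].
    have := H1 j jt Qj y (mem_head _ _) bjy; by rewrite eqxx.
  congr (ohead _ == _); rewrite -filter_predI; apply: eq_in_filter => z zt /=.
  case b: (between j k z) => //=.
  by have /andP[_ ->] := H1 j jt Qj z (@mem_behead _ (y :: t) _ zt) b.
case: (ltngtP k y) => [ky|yk|->] /= kt.
- rewrite kt; congr cons; apply: side => //; first exact: ltnW.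
    move=> j jt jy z; have jny : j != y by apply: contraNneq yt => <-.
    by rewrite /between; move: jy jny; lia.
  by move=> j jt; rewrite /between; lia.
- rewrite kt; congr cons; apply: side => // j jt.
    move=> yj z _; by rewrite /between; lia.
  by rewrite /between; lia.
- rewrite -(@filter_pred0 _ t); congr cons; apply: eq_in_filter => j jt /=.
  rewrite /first /= /between geq_minr leq_maxr /=.
  by apply/esym/negbTE; apply: contraNneq yt => -[->].
Qed.

End BinarySearchTrees.

(** * Averages over the orderings of a list *)

Section Average.
Variables (R : realFieldType) (T : eqType).
Implicit Types (l s t : seq T) (P : pred T).

(** The expectation of [phi] under a uniformly random ordering of [l]. *)
Definition avg l (phi : seq T -> R) : R :=
  (\sum_(t <- permutations l) phi t) / (size l)`!%:R.

Lemma size_permutations_neq0 l : (size l)`!%:R != 0 :> R.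
Proof. by rewrite pnatr_eq0 -lt0n fact_gt0. Qed.

Lemma eq_in_avg l phi psi :
  (forall t, perm_eq t l -> phi t = psi t) -> avg l phi = avg l psi.
Proof.
move=> h; rewrite /avg; congr (_ / _); apply: eq_big_seq => t.
by rewrite mem_permutations; exact: h.
Qed.

Lemma eq_avg l phi psi : phi =1 psi -> avg l phi = avg l psi.
Proof. by move=> h; apply: eq_in_avg. Qed.

Lemma perm_avg l l' phi : perm_eq l l' -> avg l phi = avg l' phi.
Proof.
move=> ll; rewrite /avg (perm_size ll); congr (_ / _).
by apply: perm_big; exact: perm_permutations.
Qed.

Lemma avgD l phi psi : avg l (fun t => phi t + psi t) = avg l phi + avg l psi.
Proof. by rewrite /avg big_split mulrDl. Qed.

Lemma avgZ l c phi : avg l (fun t => c * phi t) = c * avg l phi.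
Proof. by rewrite /avg -big_distrr /= mulrA. Qed.

Lemma avgN l phi : avg l (fun t => - phi t) = - avg l phi.
Proof. by rewrite /avg sumrN mulNr. Qed.

Lemma avgB l phi psi : avg l (fun t => phi t - psi t) = avg l phi - avg l psi.
Proof. by rewrite avgD avgN. Qed.

Lemma avg_sum l (I : Type) (r : seq I) (Q : pred I) (F : I -> seq T -> R) :
  avg l (fun t => \sum_(i <- r | Q i) F i t) = \sum_(i <- r | Q i) avg l (F i).
Proof. by rewrite /avg exchange_big mulr_suml. Qed.

Lemma le_in_avg l phi psi :
  (forall t, perm_eq t l -> phi t <= psi t) -> avg l phi <= avg l psi.
Proof.
move=> h; rewrite /avg ler_wpM2r ?invr_ge0 //.
by rewrite big_seq [leRHS]big_seq; apply: ler_sum => t; rewrite mem_permutations => /h.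
Qed.

Lemma avg_ge0 l phi : (forall t, 0 <= phi t) -> 0 <= avg l phi.
Proof. by move=> h; rewrite /avg divr_ge0 ?sumr_ge0. Qed.

Lemma ler_norm_avg l phi : `|avg l phi| <= avg l (fun t => `|phi t|).
Proof.
rewrite /avg normrM (@ger0_norm _ _^-1) ?invr_ge0 //.
by rewrite ler_wpM2r ?invr_ge0 // ler_norm_sum.
Qed.

Lemma avg_cst l c : uniq l -> avg l (fun=> c) = c.
Proof.
move=> ul; rewrite /avg big_const_seq count_predT size_permutations //.
by rewrite iter_addr_0 -(mulr_natr c) mulfK // size_permutations_neq0.
Qed.

Lemma avg_nil phi : avg [::] phi = phi [::].
Proof.
have -> : phi [::] = avg [::] (fun=> phi [::]) by rewrite avg_cst.
by apply: eq_in_avg => t /perm_nilP ->.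
Qed.

Lemma sum_cst_seq (s : seq T) (c : R) : \sum_(x <- s) c = (size s)%:R * c.
Proof. by rewrite big_const_seq count_predT iter_addr_0 mulr_natl. Qed.

(** Decomposition according to the element [x] such that the ordering is
    [f x s]; [f] is [cons] or [rcons] below. *)
Lemma avg_split (f : T -> seq T -> seq T) l phi : uniq l -> l != [::] ->
  (forall x y s t, f x s = f y t -> x = y /\ s = t) ->
  (forall x s, perm_eq (f x s) (x :: s)) ->
  (forall t, t != [::] -> exists x s, t = f x s) ->
  avg l phi =
  (\sum_(x <- l) avg (rem x l) (fun s => phi (f x s))) / (size l)%:R.
Proof.
move=> ul l0 finj fperm fsurj.
have sl : (0 < size l)%N by case: (l) l0.
have perml : perm_eq (permutations l)
    (flatten [seq [seq f x s | s <- permutations (rem x l)] | x <- l]).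
  apply: uniq_perm; first exact: permutations_uniq.
  - apply: allpairs_uniq_dep => //; first by move=> x _; exact: permutations_uniq.
    by move=> [x s] [y t] _ _ /= /finj[-> ->].
  - move=> t; rewrite mem_permutations.
    apply/idP/allpairsPdep => [tl|[x [s [xl sl' ->]]]].
      have /fsurj [x [s tE]] : t != [::].
        by apply: contraNneq l0 => t0; rewrite -size_eq0 -(perm_size tl) t0.
      have xsl : perm_eq (x :: s) l by apply: perm_trans tl; rewrite tE perm_sym.
      have xl : x \in l by rewrite -(perm_mem xsl) mem_head.
      exists x, s; split => //; rewrite mem_permutations -(perm_cons x).
      by rewrite (perm_trans xsl) // perm_to_rem.
    rewrite (perm_trans (fperm _ _)) // perm_sym (perm_trans (perm_to_rem xl)) //.
    by rewrite perm_cons perm_sym -mem_permutations.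
rewrite /avg (perm_big _ perml) big_flatten big_map /= mulr_suml mulr_suml.
apply: eq_big_seq => x xl; rewrite big_map size_rem //.
rewrite -{1}(prednK sl) factS natrM (prednK sl) invfM mulrA.
by rewrite mulrAC.
Qed.

(** Decomposition according to the first element. *)
Lemma avg_cons l phi : uniq l -> l != [::] ->
  avg l phi =
  (\sum_(x <- l) avg (rem x l) (fun s => phi (x :: s))) / (size l)%:R.
Proof.
move=> ul l0; apply: (avg_split (f := cons)) => //.
- by move=> x y s t [].
- by move=> [|x s] // _; exists x, s.
Qed.

(** Decomposition according to the last element. *)
Lemma avg_rcons l phi : uniq l -> l != [::] ->
  avg l phi =
  (\sum_(x <- l) avg (rem x l) (fun s => phi (rcons s x))) / (size l)%:R.
Proof.
move=> ul l0; apply: (avg_split (f := fun x s => rcons s x)) => //.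
- by move=> x y s t /rcons_inj[].
- by move=> x s; rewrite perm_rcons.
- by move=> t; case/lastP: t => // s x _; exists x, s.
Qed.

Lemma filter_rem P x l : uniq l ->
  filter P (rem x l) = if P x then rem x (filter P l) else filter P l.
Proof.
move=> ul; rewrite rem_filter // -filter_predI.
case: ifP => Px.
  rewrite rem_filter ?filter_uniq // -filter_predI.
  by apply: eq_filter => z /=; rewrite andbC.
apply: eq_filter => z /=; case: eqP => [->|] /=; by rewrite ?Px ?andbT.
Qed.

Lemma avg_cons_mul l phi : uniq l ->
  \sum_(x <- l) avg (rem x l) (fun s => phi (x :: s)) =
  (size l)%:R * avg l phi.
Proof.
move=> ul; have [->|l0] := eqVneq l [::]; first by rewrite big_nil mul0r.
rewrite [avg l phi]avg_cons // mulrC divfK // pnatr_eq0.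
by rewrite -lt0n; case: (l) l0.
Qed.

(** In a random ordering of [l], the relative orders of the elements in [P] and
    of the elements outside [P] are uniform and independent. *)
Lemma avg_filter2 P l (phi : seq T -> seq T -> R) : uniq l ->
  avg l (fun s => phi (filter P s) (filter (predC P) s)) =
  avg (filter P l) (fun s1 => avg (filter (predC P) l) (fun s2 => phi s1 s2)).
Proof.
move: {2}(size l) (erefl (size l)) => m.
elim: m l phi => [|m IH] l phi sl ul.
  by rewrite (size0nil sl) /= !avg_nil.
have l0 : l != [::] by rewrite -size_eq0 sl.
rewrite avg_cons //= sl.
set A := RHS.
rewrite (bigID P) /= -big_filter -[X in _ + X]big_filter.
set S1 := (X in X + _); set S2 := (X in _ + X).
have -> : S1 = (size (filter P l))%:R * A.
  rewrite /A -avg_cons_mul ?filter_uniq //; apply: eq_big_seq => x.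
  rewrite mem_filter => /andP[Px xl]; rewrite Px /=.
  rewrite (IH _ (fun s1 s2 => phi (x :: s1) s2)) ?rem_uniq ?size_rem ?sl //.
  by rewrite !filter_rem //= Px.
have -> : S2 = (size (filter (predC P) l))%:R * A.
  rewrite /A -avgZ.
  under [RHS]eq_avg do rewrite -avg_cons_mul ?filter_uniq //.
  rewrite avg_sum; apply: eq_big_seq => x.
  rewrite mem_filter => /andP[/= /negbTE Px xl]; rewrite Px /=.
  rewrite (IH _ (fun s1 s2 => phi s1 (x :: s2))) ?rem_uniq ?size_rem ?sl //.
  by rewrite !filter_rem //= Px.
by rewrite -mulrDl -natrD !size_filter count_predC sl mulrAC mulfV ?mul1r //.
Qed.

Lemma avg_filter P l (phi : seq T -> R) : uniq l ->
  avg l (fun s => phi (filter P s)) = avg (filter P l) phi.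
Proof.
move=> ul; rewrite (avg_filter2 P (fun s1 _ => phi s1)) //.
by apply: eq_avg => s; rewrite avg_cst ?filter_uniq.
Qed.

Lemma avg_ohead l x : uniq l -> x \in l ->
  avg l (fun s => (ohead s == Some x)%:R) = (size l)%:R^-1.
Proof.
move=> ul xl; rewrite avg_cons; [|by []|by case: (l) xl].
rewrite (bigD1_seq x) //= big1_seq ?addr0.
  by rewrite eqxx avg_cst ?rem_uniq // mul1r.
move=> y /andP[/negbTE yx _]; rewrite (inj_eq Some_inj) yx.
by rewrite avg_cst ?rem_uniq.
Qed.

(** Each of the elements satisfying [P] is equally likely to come first. *)
Lemma avg_first P l x : uniq l -> x \in l -> P x ->
  avg l (fun s => (first P x s)%:R) = (count P l)%:R^-1.
Proof.
move=> ul xl Px; rewrite (avg_filter P (fun s => (ohead s == Some x)%:R)) //.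
by rewrite avg_ohead ?filter_uniq ?mem_filter ?Px // size_filter.
Qed.

End Average.

(** * Sums of independent Bernoulli variables *)

Section Bernoulli.
Variable R : realFieldType.
Implicit Types (ps : seq R) (g : nat -> R).

(** [bern ps g] is the expectation of [g] at the sum of independent Bernoulli
    variables with parameters [ps]. *)
Fixpoint bern ps g : R :=
  if ps is p :: ps' then (1 - p) * bern ps' g + p * bern ps' (g \o S)
  else g 0%N.

Lemma eq_bern ps g1 g2 : g1 =1 g2 -> bern ps g1 = bern ps g2.
Proof.
elim: ps g1 g2 => [|p ps IH] g1 g2 h /=; first exact: h.
by rewrite (IH _ _ h) (IH (g1 \o S) (g2 \o S)) // => x; exact: h.
Qed.

Lemma bernD ps g1 g2 : bern ps (fun x => g1 x + g2 x) = bern ps g1 + bern ps g2.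
Proof.
elim: ps g1 g2 => [|p ps IH] g1 g2 //=.
by rewrite IH (IH (g1 \o S) (g2 \o S)) !mulrDr addrACA.
Qed.

Lemma bernZ ps c g : bern ps (fun x => c * g x) = c * bern ps g.
Proof.
elim: ps g => [|p ps IH] g //=.
by rewrite IH (IH (g \o S)) mulrDr !(mulrCA c).
Qed.

Lemma bernN ps g : bern ps (fun x => - g x) = - bern ps g.
Proof.
by under eq_bern do rewrite -mulN1r; rewrite bernZ mulN1r.
Qed.

Lemma bernB ps g1 g2 : bern ps (fun x => g1 x - g2 x) = bern ps g1 - bern ps g2.
Proof. by rewrite bernD bernN. Qed.

Lemma bern_cst ps c : bern ps (fun=> c) = c.
Proof. by elim: ps => //= p ps IH; rewrite /comp /= IH; ring. Qed.

(** The elements of [ps] are probabilities. *)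
Definition probs ps := all (fun p => 0 <= p <= 1) ps.

Lemma le_bern ps g1 g2 : probs ps -> (forall x, g1 x <= g2 x) ->
  bern ps g1 <= bern ps g2.
Proof.
elim: ps g1 g2 => [|p ps IH] g1 g2 /=; first by move=> _; exact.
move=> /andP[/andP[p0 p1] hps] h.
by apply: lerD; apply: ler_wpM2l; rewrite ?subr_ge0 //; apply: IH => // x;
  exact: h.
Qed.

Lemma ler_norm_bern ps g : probs ps -> `|bern ps g| <= bern ps (fun x => `|g x|).
Proof.
move=> h; rewrite ler_norml -bernN; apply/andP; split; apply: le_bern => // x.
  by rewrite lerNnormlW.
exact: ler_norm.
Qed.

Lemma bern_cat ps1 ps2 g :
  bern (ps1 ++ ps2) g = bern ps1 (fun x => bern ps2 (fun y => g (x + y)%N)).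
Proof.
elim: ps1 g => [|p ps1 IH] g //=.
by rewrite !IH.
Qed.

(** The mean and the variance of the sum of independent Bernoulli variables with
    parameters [ps]. *)
Definition bmean ps : R := \sum_(p <- ps) p.
Definition bvar ps : R := \sum_(p <- ps) p * (1 - p).

Lemma bern_mean ps : bern ps (fun x => x%:R) = bmean ps.
Proof.
elim: ps => [|p ps IH] /=; first by rewrite /bmean big_nil.
have -> : bern ps ((fun x => x%:R) \o S) = bern ps (fun x => x%:R) + 1.
  rewrite -[X in _ + X](bern_cst ps) -bernD; apply: eq_bern => x /=.
  by rewrite -natr1.
by rewrite IH /bmean big_cons; ring.
Qed.

(** Let S be the sum, and let S_i be S without its i-th term. In the identity
    E[(S - E S) g(S)] = sum_i p_i (1 - p_i) E[g(S_i + 1) - g(S_i)], the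
    increment of g is replaced by G(S), where S is S_i or S_i + 1, with an error
    at most e(S). *)
Lemma bern_stein ps (g G e : nat -> R) : probs ps ->
  (forall x, `|g x.+1 - g x - G x| <= e x) ->
  (forall x, `|g x.+1 - g x - G x.+1| <= e x.+1) ->
  `|bern ps (fun x => (x%:R - bmean ps) * g x) - bvar ps * bern ps G|
    <= bvar ps * bern ps e.
Proof.
elim: ps g G e => [|p ps IH] g G e.
  by rewrite /bmean /bvar !big_nil /= !subrr !mul0r subrr normr0.
move=> /= /andP[/andP[p0 p1] hps] h1 h2.
rewrite [bmean _]big_cons [bvar _]big_cons -/(bmean ps) -/(bvar ps).
have H1 := IH g G e hps h1 h2.
have H2 := IH (g \o S) (G \o S) (e \o S) hps (fun x => h1 x.+1) (fun x => h2 x.+1).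
pose a := bern ps (fun x => (x%:R - bmean ps) * g x).
pose b := bern ps (fun x => (x%:R - bmean ps) * g x.+1).
have E1 : bern ps (fun x => (x%:R - (p + bmean ps)) * g x) = a - p * bern ps g.
  by rewrite -bernZ -bernB; apply: eq_bern => x; ring.
have E2 : bern ps ((fun x => (x%:R - (p + bmean ps)) * g x) \o S) =
    b + (1 - p) * bern ps (g \o S).
  by rewrite -bernZ -bernD; apply: eq_bern => x /=; rewrite -natr1; ring.
rewrite E1 E2.
have H3 : `|bern ps (g \o S) - bern ps g -
    ((1 - p) * bern ps G + p * bern ps (G \o S))| <=
    (1 - p) * bern ps e + p * bern ps (e \o S).
  have -> : bern ps (g \o S) - bern ps g -
    ((1 - p) * bern ps G + p * bern ps (G \o S)) =
    (1 - p) * bern ps (fun x => g x.+1 - g x - G x) +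
    p * bern ps (fun x => g x.+1 - g x - G x.+1).
    by rewrite !bernB /comp; ring.
  rewrite (le_trans (ler_normD _ _)) // !normrM (ger0_norm p0).
  rewrite (@ger0_norm _ (1 - p)) ?subr_ge0 //; apply: lerD; apply: ler_wpM2l;
    rewrite ?subr_ge0 //; apply: (le_trans (ler_norm_bern _ _)) => //.
    exact: le_bern.
  exact: le_bern.
have q0 : 0 <= 1 - p by rewrite subr_ge0.
move: H1 H2 H3; rewrite -/a -/b !ler_norml.
set u := bern ps G; set u' := bern ps (G \o S).
set w := bern ps e; set w' := bern ps (e \o S).
set v := bvar ps; set t := bern ps (g \o S); set t' := bern ps g.
move=> /andP[A1 A2] /andP[B1 B2] /andP[C1 C2].
have D1 := ler_wpM2l q0 A1; have D2 := ler_wpM2l q0 A2.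
have D3 := ler_wpM2l p0 B1; have D4 := ler_wpM2l p0 B2.
have pq0 : 0 <= p * (1 - p) by rewrite mulr_ge0.
have D5 := ler_wpM2l pq0 C1; have D6 := ler_wpM2l pq0 C2.
apply/andP; split; lra.
Qed.

Lemma bern_var ps : probs ps ->
  bern ps (fun x => (x%:R - bmean ps) ^+ 2) = bvar ps.
Proof.
move=> hps.
have := @bern_stein ps (fun x => x%:R - bmean ps) (fun=> 1) (fun=> 0) hps.
rewrite !bern_cst mulr1 mulr0 normr_le0 subr_eq0 => h.
apply/eqP/h => x; by rewrite -natr1 normr_le0; apply/eqP; ring.
Qed.

End Bernoulli.

(** * The number of ancestors in a random binary search tree *)

Section Records.
Variables (R : realFieldType).

(** [invs m] is [[:: 1/m; ...; 1/2; 1]]. *)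
Fixpoint invs m : seq R := if m is m'.+1 then m%:R^-1 :: invs m' else [::].

Lemma probs_invs m : probs (invs m).
Proof.
elim: m => //= m ->; rewrite andbT invr_ge0 ler0n /=.
by rewrite invf_le1 ?ltr0n // ler1n.
Qed.

Section ListRecords.
Variable T : eqType.
Implicit Types (l s : seq T).

(** The number of [i] such that [l_i] is the first of the elements [l_i],
    [l_(i+1)], ... in the ordering [s] of [l]. *)
Fixpoint reccount l s : nat :=
  if l is j :: l' then ((ohead s == Some j) + reccount l' (filter (mem l') s))%N
  else 0%N.

Lemma filter_perm_id l s : perm_eq s l -> filter (mem l) s = s.
Proof. by move=> sl; apply/all_filterP/allP => x; rewrite (perm_mem sl). Qed.

(** The first element of a random ordering of [j :: l] is [j] with probability
    1/(|l|+1), independently of the order of the elements of [l]. *)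
Lemma avg_ohead_filter j l (phi : bool -> seq T -> R) : uniq (j :: l) ->
  avg (j :: l) (fun s => phi (ohead s == Some j) (filter (mem l) s)) =
  (1 - (size l).+1%:R^-1) * avg l (phi false) +
  (size l).+1%:R^-1 * avg l (phi true).
Proof.
move=> ujl; have /andP[jl ul] := ujl.
rewrite avg_cons // big_cons.
have -> : rem j (j :: l) = l by rewrite /= eqxx.
have -> : avg l (fun s => phi (ohead (j :: s) == Some j)
    (filter (mem l) (j :: s))) = avg l (phi true).
  apply: eq_in_avg => s sl; rewrite [filter _ (j :: s)]/= (negbTE jl) /=.
  by rewrite eqxx (filter_perm_id sl).
have -> : \sum_(x <- l) avg (rem x (j :: l)) (fun s =>
    phi (ohead (x :: s) == Some j) (filter (mem l) (x :: s))) =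
    (size l)%:R * avg l (phi false).
  rewrite -avg_cons_mul //; apply: eq_big_seq => x xl.
  have jx : (x == j) = false by apply: contraNF jl => /eqP <-.
  have -> : rem x (j :: l) = j :: rem x l by rewrite /= eq_sym jx.
  have u' : uniq (j :: rem x l).
    by rewrite /= rem_uniq // andbT; apply: contra jl; exact: mem_rem.
  have E : filter (mem l) (j :: rem x l) = rem x l.
    rewrite /= (negbTE jl); apply/all_filterP/allP => y /mem_rem.
    by rewrite inE.
  rewrite -[in RHS]E -(avg_filter (mem l) (fun s => phi false (x :: s))) //.
  by apply: eq_avg => s; rewrite /= xl (inj_eq Some_inj) jx.
rewrite /= -natr1.
have h : (size l)%:R + 1 != 0 :> R by rewrite natr1 pnatr_eq0.
by field.
Qed.

(** The records are independent events. *)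
Lemma avg_reccount l (g : nat -> R) : uniq l ->
  avg l (fun s => g (reccount l s)) = bern (invs (size l)) g.
Proof.
elim: l g => [|j l IH] g; first by rewrite avg_nil.
move=> ujl; have /andP[_ ul] := ujl.
have := avg_ohead_filter (fun b s => g (b + reccount l s)%N) ujl.
by move=> /= ->; rewrite (IH g ul) (IH (g \o S) ul).
Qed.

End ListRecords.

(** Records when the elements of an interval are listed increasingly or
    decreasingly, in terms of the element that comes first in a subinterval. *)
Lemma reccount_iota (m j : nat) (s : seq nat) :
  reccount (iota j m) (filter (mem (iota j m)) s) =
  (\sum_(i <- iota j m) first (fun z => i <= z < j + m) i s)%N.
Proof.
elim: m j => [|m IH] j; first by rewrite big_nil.
have -> : iota j m.+1 = j :: iota j.+1 m by [].
rewrite big_cons -addSnnS -IH [LHS]/=; congr (_ + _)%N.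
  rewrite /first; congr (nat_of_bool (ohead _ == _)); apply: eq_filter => z /=.
  by rewrite in_cons mem_iota; lia.
congr reccount; rewrite -filter_predI; apply: eq_filter => z /=.
by rewrite in_cons !mem_iota; lia.
Qed.

Lemma reccount_rev_iota (m j : nat) (s : seq nat) :
  reccount (rev (iota j m)) (filter (mem (iota j m)) s) =
  (\sum_(i <- iota j m) first (fun z => j <= z <= i) i s)%N.
Proof.
elim: m => [|m IH]; first by rewrite big_nil.
rewrite -addn1 iotaD rev_cat big_cat big_seq1 -IH /= addnC; congr (_ + _)%N.
  congr reccount; rewrite -filter_predI; apply: eq_filter => z /=.
  by rewrite mem_rev mem_cat; case: (z \in _).
rewrite /first; congr (nat_of_bool (ohead _ == _)); apply: eq_filter => z /=.
by rewrite mem_cat mem_iota mem_seq1; lia.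
Qed.

End Records.

Section Ancestors.
Variables (R : realFieldType).
Implicit Types (n k j : nat) (s t : seq nat).

(** [j] is an ancestor of [k], or [k] itself, in the search tree of [s]; see
    [root_path_bst]. *)
Definition ancestor k j s := first (between j k) j s.

(** [j] would be an ancestor of [k] if [k] were inserted after the other keys
    of [s]. *)
Definition late_ancestor k j s :=
  first (fun z => (z != k) && between j k z) j s.

(** The number of ancestors, among the keys 1, ..., n, that the key [k] would
    have if it were inserted last. *)
Definition late_depth n k s :=
  (\sum_(j <- iota 1 n | j != k) late_ancestor k j s)%N.

Lemma mem_iota1 n k : (k \in iota 1 n) = (1 <= k <= n)%N.
Proof. by rewrite mem_iota add1n ltnS. Qed.

Lemma depth_bst n k s : perm_eq s (iota 1 n) -> (1 <= k <= n)%N ->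
  depth k (bst s) = (\sum_(j <- iota 1 n | j != k) ancestor k j s)%N.
Proof.
move=> sn kn; have us : uniq s by rewrite (perm_uniq sn) iota_uniq.
have ks : k \in s by rewrite (perm_mem sn) mem_iota1.
rewrite /depth root_path_bst // size_filter -sum1_count big_mkcond /=.
rewrite (bigD1_seq k) //= -big_mkcondr.
have -> : first (between k k) k s.
  rewrite /first; have -> : filter (between k k) s = filter (pred1 k) s.
    by apply: eq_filter => z; rewrite /between /=; lia.
  by rewrite filter_pred1_uniq.
rewrite add1n /= (perm_big _ sn) /= big_mkcondr /=.
by apply: eq_bigr => j _; rewrite /ancestor; case: first.
Qed.

Lemma wdepth_bst n k s : perm_eq s (iota 1 n) -> (1 <= k <= n)%N ->
  wdepth k (bst s) = (k + \sum_(j <- iota 1 n | j != k) j * ancestor k j s)%N.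
Proof.
move=> sn kn; have us : uniq s by rewrite (perm_uniq sn) iota_uniq.
have ks : k \in s by rewrite (perm_mem sn) mem_iota1.
rewrite /wdepth root_path_bst // big_filter big_mkcond /=.
rewrite (bigD1_seq k) //=.
have -> : first (between k k) k s.
  rewrite /first; have -> : filter (between k k) s = filter (pred1 k) s.
    by apply: eq_filter => z; rewrite /between /=; lia.
  by rewrite filter_pred1_uniq.
rewrite (perm_big _ sn) /=; congr (_ + _)%N.
by apply: eq_bigr => j _; rewrite /ancestor; case: first; rewrite ?muln1 ?muln0.
Qed.

Lemma ancestor_rcons k j t : k \notin t -> j \in t ->
  ancestor k j (rcons t k) = late_ancestor k j t.
Proof.
move=> kt jt; rewrite /ancestor /late_ancestor /first filter_rcons.
have -> : between j k k by rewrite /between; lia.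
have -> : filter (between j k) t =
    filter (fun z => (z != k) && between j k z) t.
  apply: eq_in_filter => z zt; case: eqP => [zk|//].
  by rewrite -zk zt in kt.
have : j \in filter (fun z => (z != k) && between j k z) t.
  rewrite mem_filter jt /between andbT; apply/andP; split; last by lia.
  by apply: contraNneq kt => <-.
by case: (filter _ _).
Qed.

Lemma ancestor_late k j s : j != k -> ancestor k j s -> late_ancestor k j s.
Proof.
move=> jk; rewrite /ancestor /late_ancestor /first.
rewrite (filter_predI (fun z => z != k)).
case: (filter (between j k) s) => //= x s' /eqP [->].
by rewrite jk.
Qed.

Lemma filter_rem_iota n k : filter (predC1 k) (iota 1 n) = rem k (iota 1 n).
Proof. by rewrite rem_filter ?iota_uniq. Qed.

Lemma mem_rem_iota n k z :
  (z \in rem k (iota 1 n)) = (z != k) && (1 <= z <= n)%N.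
Proof. by rewrite mem_rem_uniq ?iota_uniq // inE mem_iota1. Qed.

Lemma late_ancestor_filter k j s :
  late_ancestor k j (filter (predC1 k) s) = late_ancestor k j s.
Proof.
rewrite /late_ancestor /first -filter_predI.
congr (ohead _ == _); apply: eq_filter => z /=.
by case: (z != k); rewrite ?andbT ?andbF.
Qed.

Lemma late_depth_filter n k s :
  late_depth n k (filter (predC1 k) s) = late_depth n k s.
Proof. by apply: eq_bigr => j _; rewrite late_ancestor_filter. Qed.

Lemma big_iota_neq (V : nmodType) n k (F : nat -> V) : (1 <= k <= n)%N ->
  \sum_(j <- iota 1 n | j != k) F j =
  \sum_(j <- iota 1 k.-1) F j + \sum_(j <- iota k.+1 (n - k)) F j.
Proof.
move=> kn; have -> : n = (k.-1 + (n - k).+1)%N by lia.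
rewrite iotaD big_cat /=; congr (_ + _).
  rewrite big_mkcond; apply: eq_big_seq => j; rewrite mem_iota => jk.
  by rewrite (_ : j != k) //; lia.
have -> : (1 + k.-1 = k)%N by lia.
have -> : (k.-1 + (n - k).+1 - k = n - k)%N by lia.
rewrite big_cons eqxx /= big_mkcond; apply: eq_big_seq => j.
by rewrite mem_iota => jk; rewrite (_ : j != k) //; lia.
Qed.

(** The distance to [k] of the elements of 1, ..., n other than [k]. *)
Lemma big_iota_dist (V : nmodType) n k (F : nat -> V) : (1 <= k <= n)%N ->
  \sum_(j <- iota 1 n | j != k) F ((j - k) + (k - j))%N =
  \sum_(i <- iota 1 k.-1) F i + \sum_(i <- iota 1 (n - k)) F i.
Proof.
move=> kn; rewrite big_iota_neq //; congr (_ + _).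
  have pk : perm_eq (map (fun j => k - j)%N (iota 1 k.-1)) (iota 1 k.-1).
    apply: uniq_perm; rewrite ?iota_uniq //.
      by rewrite map_inj_in_uniq ?iota_uniq // => i j; rewrite !mem_iota; lia.
    move=> j; rewrite mem_iota; apply/mapP/idP => [[i]|jk].
      by rewrite mem_iota; lia.
    by exists (k - j)%N; rewrite ?mem_iota; lia.
  rewrite -[RHS](perm_big _ pk) big_map.
  by apply: eq_big_seq => j; rewrite mem_iota => jk; congr F; lia.
have -> : iota k.+1 (n - k) = map (addn k) (iota 1 (n - k)).
  by rewrite -iotaDl addn1.
rewrite big_map; apply: eq_big_seq => j _; congr F; lia.
Qed.

Lemma eq_iota_neq (V : nmodType) n k (F G : nat -> V) :
  (forall j, (1 <= j <= n)%N -> j != k -> F j = G j) ->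
  \sum_(j <- iota 1 n | j != k) F j = \sum_(j <- iota 1 n | j != k) G j.
Proof.
move=> h; rewrite big_mkcond [RHS]big_mkcond; apply: eq_big_seq => j.
by rewrite mem_iota1 => jn; case: ifP => // jk; exact: h.
Qed.

Lemma late_depthE n k s : (1 <= k <= n)%N -> perm_eq s (rem k (iota 1 n)) ->
  late_depth n k s =
  (reccount (iota 1 k.-1) (filter (fun z => (z < k)%N) s) +
   reccount (rev (iota k.+1 (n - k))) (filter (predC (fun z => (z < k)%N)) s))%N.
Proof.
move=> kn sl.
have memE z : z \in s -> (1 <= z <= n)%N && (z != k).
  by rewrite (perm_mem sl) mem_rem_iota andbC.
have -> : filter (fun z => (z < k)%N) s = filter (mem (iota 1 k.-1)) s.
  by apply: eq_in_filter => z /memE; rewrite /= mem_iota; lia.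
have -> : filter (predC (fun z => (z < k)%N)) s =
    filter (mem (iota k.+1 (n - k))) s.
  by apply: eq_in_filter => z /memE; rewrite /= mem_iota; lia.
rewrite reccount_iota reccount_rev_iota /late_depth.
rewrite (@big_iota_neq nat) //; congr (_ + _)%N;
  apply: eq_big_seq => j; rewrite mem_iota => jk;
  rewrite /late_ancestor /first; congr (nat_of_bool (ohead _ == _));
  apply: eq_in_filter => z /memE; rewrite /between; lia.
Qed.

(** The left and the right late ancestors of [k] are the records of two
    independent random orderings. *)
Lemma avg_late_depth_rem n k (g : nat -> R) : (1 <= k <= n)%N ->
  avg (rem k (iota 1 n)) (fun s => g (late_depth n k s)) =
  bern (invs R k.-1 ++ invs R (n - k)) g.
Proof.
move=> kn; pose P := fun z => (z < k)%N.
rewrite (eq_in_avg (psi := fun s => g (reccount (iota 1 k.-1) (filter P s) +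
   reccount (rev (iota k.+1 (n - k))) (filter (predC P) s))%N)); last first.
  by move=> t tl; rewrite late_depthE.
rewrite (@avg_filter2 _ _ P _ (fun s1 s2 => g (reccount (iota 1 k.-1) s1 +
   reccount (rev (iota k.+1 (n - k))) s2)%N)) ?rem_uniq ?iota_uniq //.
have pl : perm_eq (filter P (rem k (iota 1 n))) (iota 1 k.-1).
  apply: uniq_perm; rewrite ?filter_uniq ?rem_uniq ?iota_uniq // => /= z.
  rewrite mem_filter mem_rem_iota mem_iota /P /=.
  lia.
have pr : perm_eq (filter (predC P) (rem k (iota 1 n)))
    (rev (iota k.+1 (n - k))).
  apply: uniq_perm; rewrite ?rev_uniq ?filter_uniq ?rem_uniq ?iota_uniq // => /= z.
  rewrite mem_filter mem_rem_iota mem_rev mem_iota /P /=.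
  lia.
rewrite (perm_avg _ pl) bern_cat -[in bern (invs R k.-1)](size_iota 1 k.-1).
rewrite -avg_reccount ?iota_uniq //; apply: eq_avg => s1.
rewrite (perm_avg _ pr) -[in RHS](size_iota k.+1 (n - k)) -size_rev.
by rewrite -avg_reccount // rev_uniq iota_uniq.
Qed.

Lemma avg_late_depth n k (g : nat -> R) : (1 <= k <= n)%N ->
  avg (iota 1 n) (fun s => g (late_depth n k s)) =
  bern (invs R k.-1 ++ invs R (n - k)) g.
Proof.
move=> kn; rewrite -avg_late_depth_rem // -filter_rem_iota.
rewrite -(avg_filter _ (fun s => g (late_depth n k s))) ?iota_uniq //.
by apply: eq_avg => s; rewrite late_depth_filter.
Qed.

Lemma count_iota1 n (P : pred nat) a b : (1 <= a)%N -> (b <= n)%N ->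
  (a <= b.+1)%N -> P =1 (fun z => (a <= z <= b)%N) ->
  count P (iota 1 n) = (b.+1 - a)%N.
Proof.
move=> a1 bn ab PE; rewrite -size_filter -[RHS](size_iota a).
apply: perm_size; apply: uniq_perm; rewrite ?filter_uniq ?iota_uniq // => /= z.
by rewrite mem_filter !mem_iota PE; lia.
Qed.

Lemma avg_ancestor n k j : (1 <= k <= n)%N -> (1 <= j <= n)%N ->
  avg (iota 1 n) (fun s => (ancestor k j s)%:R) =
  ((j - k) + (k - j)).+1%:R^-1 :> R.
Proof.
move=> kn jn; rewrite avg_first ?iota_uniq ?mem_iota1 //; last first.
  by rewrite /between; lia.
rewrite (@count_iota1 n _ (minn j k) (maxn j k)) //; last 3 first.
- lia.
- lia.
- lia.
by congr (_%:R^-1); lia.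
Qed.

Lemma avg_late_ancestor n k j : (1 <= k <= n)%N -> (1 <= j <= n)%N -> j != k ->
  avg (iota 1 n) (fun s => (late_ancestor k j s)%:R) =
  ((j - k) + (k - j))%:R^-1 :> R.
Proof.
move=> kn jn jk; rewrite avg_first ?iota_uniq ?mem_iota1 //; last first.
  by rewrite jk /between; lia.
congr (_%:R^-1); have [jk'|kj] := ltnP j k.
  rewrite (@count_iota1 n _ j k.-1); try lia.
  by move=> z; rewrite /between; lia.
rewrite (@count_iota1 n _ k.+1 j); try lia.
by move=> z; rewrite /between; lia.
Qed.

Lemma avg_late_ancestor_rem n k j : (1 <= k <= n)%N -> (1 <= j <= n)%N ->
  j != k -> avg (rem k (iota 1 n)) (fun s => (late_ancestor k j s)%:R) =
  ((j - k) + (k - j))%:R^-1 :> R.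
Proof.
move=> kn jn jk; rewrite -(avg_late_ancestor kn jn jk) -filter_rem_iota.
rewrite -(avg_filter _ (fun s => (late_ancestor k j s)%:R)) ?iota_uniq //.
by apply: eq_avg => s; rewrite late_ancestor_filter.
Qed.

(** Moving [k] to the end of the list adds at most 2 ancestors on average. *)
Lemma avg_late_depth_sub n k : (1 <= k <= n)%N ->
  avg (iota 1 n) (fun s => `|(depth k (bst s))%:R - (late_depth n k s)%:R|)
  <= 2 :> R.
Proof.
move=> kn.
rewrite (eq_in_avg (psi := fun s => \sum_(j <- iota 1 n | j != k)
    ((late_ancestor k j s)%:R - (ancestor k j s)%:R))); last first.
  move=> s sn; rewrite (depth_bst sn kn) !natr_sum distrC sumrB ger0_norm //.
  rewrite subr_ge0; apply: ler_sum => j jk; rewrite ler_nat.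
  by case: (boolP (ancestor k j s)) => // /(ancestor_late jk) ->.
rewrite avg_sum (eq_iota_neq (G := fun j =>
    ((j - k) + (k - j))%:R^-1 - ((j - k) + (k - j)).+1%:R^-1)); last first.
  by move=> j jn jk; rewrite avgB avg_late_ancestor // avg_ancestor.
rewrite (big_iota_dist (fun i => i%:R^-1 - i.+1%:R^-1)) //.
have tele m : \sum_(i <- iota 1 m) (i%:R^-1 - i.+1%:R^-1) <= 1 :> R.
  rewrite -[X in iota 1 X](addnK 1%N) addn1 -/(index_iota 1 m.+1).
  under eq_bigr do rewrite -opprB.
  rewrite sumrN telescope_sumr // invr1 opprB gerBl invr_ge0.
  exact: ler0n.
by rewrite (le_trans (lerD (tele _) (tele _))).
Qed.

Lemma norm_wsum_le n k (A : nat -> bool) : (k <= n)%N ->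
  `|k%:R + \sum_(j <- iota 1 n | j != k) j%:R * (A j)%:R -
    k%:R * \sum_(j <- iota 1 n | j != k) (A j)%:R| <=
  k%:R + \sum_(j <- iota 1 n | j != k) ((j - k) + (k - j))%:R * (A j)%:R :> R.
Proof.
move=> kn; rewrite -addrA mulr_sumr -sumrB (le_trans (ler_normD _ _)) //.
rewrite ger0_norm // lerD2l (le_trans (ler_norm_sum _ _ _)) //.
apply: ler_sum => j _; rewrite -mulrBl normrM (@ger0_norm _ (A j)%:R) //.
apply: ler_wpM2r => //; have [jk|kj] := leqP j k.
  by rewrite distrC -natrB // ger0_norm // ler_nat leq_addl.
by rewrite -natrB ?(ltnW kj) // ger0_norm // ler_nat leq_addr.
Qed.

Lemma sum_dist_le n k (F : nat -> R) : (1 <= k <= n)%N ->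
  (forall j, (1 <= j <= n)%N -> j != k -> F j <= ((j - k) + (k - j))%:R^-1) ->
  k%:R + \sum_(j <- iota 1 n | j != k) ((j - k) + (k - j))%:R * F j <=
  2 * n%:R :> R.
Proof.
move=> kn hF; rewrite mulr_natl mulr2n lerD //; first by rewrite ler_nat; lia.
have -> : n%:R = \sum_(j <- iota 1 n) 1 :> R.
  by rewrite sum_cst_seq size_iota mulr1.
rewrite big_mkcond big_seq [leRHS]big_seq; apply: ler_sum => j.
rewrite mem_iota1 => jn; case: ifP => [jk|_]; last exact: ler01.
apply: le_trans (ler_wpM2l (ler0n _ _) (hF j jn jk)) _.
by rewrite mulfV // pnatr_eq0; move: jk; lia.
Qed.

(** A key at distance i from [k] is an ancestor with probability 1/(i+1), hence
    contributes at most 1 to the mean. *)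
Lemma avg_wdepth_sub n k : (1 <= k <= n)%N ->
  avg (iota 1 n) (fun s =>
    `|(wdepth k (bst s))%:R - k%:R * (depth k (bst s))%:R|) <= 2 * n%:R :> R.
Proof.
move=> kn; apply: le_trans (_ : avg (iota 1 n) (fun s => k%:R +
  \sum_(j <- iota 1 n | j != k) ((j - k) + (k - j))%:R * (ancestor k j s)%:R)
  <= _).
  apply: le_in_avg => s sn; rewrite (depth_bst sn) // (wdepth_bst sn) //.
  rewrite natrD !natr_sum; under eq_bigr do rewrite natrM.
  by apply: norm_wsum_le; case/andP: kn.
rewrite avgD avg_cst ?iota_uniq // avg_sum.
under eq_bigr do rewrite avgZ.
apply: sum_dist_le => // j jn jk; rewrite avg_ancestor //.
by rewrite lef_pV2 ?posrE ?ltr0n ?ler_nat //; move: jk; lia.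
Qed.

Lemma depth_bst_last n k t : (1 <= k <= n)%N -> perm_eq t (rem k (iota 1 n)) ->
  depth k (bst (rcons t k)) = late_depth n k t.
Proof.
move=> kn tl; have kt : k \notin t by rewrite (perm_mem tl) mem_rem_iota eqxx.
have pt : perm_eq (rcons t k) (iota 1 n).
  rewrite perm_rcons perm_sym (perm_trans (perm_to_rem (_ : k \in _))) //.
    by rewrite mem_iota1.
  by rewrite perm_cons perm_sym.
rewrite (depth_bst pt) //; apply: eq_iota_neq => j jn jk.
by rewrite ancestor_rcons // (perm_mem tl) mem_rem_iota jk.
Qed.

(** When [k] is inserted last, a key at distance i is an ancestor with
    probability 1/i. *)
Lemma avg_wdepth_last_sub n k : (1 <= k <= n)%N ->
  avg (rem k (iota 1 n)) (fun t => `|(wdepth k (bst (rcons t k)))%:R -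
    k%:R * (late_depth n k t)%:R|) <= 2 * n%:R :> R.
Proof.
move=> kn; apply: le_trans (_ : avg (rem k (iota 1 n)) (fun s => k%:R +
  \sum_(j <- iota 1 n | j != k) ((j - k) + (k - j))%:R *
    (late_ancestor k j s)%:R) <= _).
  apply: le_in_avg => t tl.
  have kt : k \notin t by rewrite (perm_mem tl) mem_rem_iota eqxx.
  have pt : perm_eq (rcons t k) (iota 1 n).
    rewrite perm_rcons perm_sym (perm_trans (perm_to_rem (_ : k \in _))) //.
      by rewrite mem_iota1.
    by rewrite perm_cons perm_sym.
  rewrite (wdepth_bst pt) // natrD !natr_sum.
  have -> : \sum_(j <- iota 1 n | j != k) (j * ancestor k j (rcons t k))%:R =
    \sum_(j <- iota 1 n | j != k) j%:R * (late_ancestor k j t)%:R :> R.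
    apply: eq_iota_neq => j jn jk.
    by rewrite ancestor_rcons ?natrM // (perm_mem tl) mem_rem_iota jk.
  by apply: norm_wsum_le; case/andP: kn.
rewrite avgD avg_cst ?rem_uniq ?iota_uniq // avg_sum.
under eq_bigr do rewrite avgZ.
by apply: sum_dist_le => // j jn jk; rewrite avg_late_ancestor_rem.
Qed.

(** Having [i] as left ancestor and having [j] as right ancestor are positively
    correlated. *)
Lemma avg_first2 n i k j : (1 <= i <= k)%N -> (k <= j <= n)%N ->
  avg (iota 1 n) (fun s => (first (fun z => i <= z <= k)%N i s)%:R *
    (first (fun z => k <= z <= j)%N j s)%:R) >=
  (k.+1 - i)%:R^-1 * (j.+1 - k)%:R^-1 :> R.
Proof.
move=> ik kj; pose P z := (i <= z <= j)%N.
pose phi (s : seq nat) : R := (first (fun z => i <= z <= k)%N i s)%:R *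
    (first (fun z => k <= z <= j)%N j s)%:R.
rewrite (eq_avg _ (psi := fun s => phi (filter P s))); last first.
  move=> s; rewrite /phi /first -!filter_predI; congr (_%:R * _%:R);
    congr (nat_of_bool (ohead _ == _)); apply: eq_filter => z /=; rewrite /P;
    lia.
rewrite avg_filter ?iota_uniq //; set l := filter P _.
have ul : uniq l by rewrite filter_uniq // iota_uniq.
have memP z : (z \in l) = P z.
  by rewrite mem_filter mem_iota1 /P; lia.
have count_l Q a b : Q =1 (fun z => (a <= z <= b)%N) -> (i <= a)%N -> (a <= b)%N ->
    (b <= j)%N -> count Q l = (b.+1 - a)%N.
  move=> QE ia ab bj; rewrite count_filter (@count_iota1 n _ a b); try lia.
  by move=> z; rewrite /= QE /P; lia.
have sl : size l = (j.+1 - i)%N.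
  by rewrite -(count_predT l) -(count_l P i j); first apply: eq_in_count;
   [move=> z; rewrite memP /= => ->| by [] | by [] | lia | by []].
have pre1 (a b x : nat) : (i <= a)%N -> (a <= b)%N -> (b <= j)%N -> x \in l ->
   ~~ (a <= x <= b)%N -> forall y, (a <= y <= b)%N ->
   avg (rem x l) (fun s => (first (fun z => a <= z <= b)%N y s)%:R) =
   (b.+1 - a)%:R^-1 :> R.
  move=> ia ab bj xl xab y yab; rewrite avg_first ?rem_uniq //; last first.
    rewrite mem_rem_uniq // inE memP /P andbC.
    apply/andP; split; first lia.
    by apply: contraNneq xab => <-.
  rewrite rem_filter // count_filter -(count_l (fun z => a <= z <= b)%N a b) //.
  congr (_%:R^-1); apply: eq_count => z /=.
  by case: eqP => [->|]; rewrite ?(negbTE xab) ?andbT.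
(* If [i] or [j] is [k], one of the two events is certain. Otherwise one of
   them comes first among the elements of [l], and two of the terms of the
   decomposition by the first element suffice. *)
have [ik1|ikn] := eqVneq i k.
  rewrite ik1 subSnn invr1 mul1r -(count_l (fun z => k <= z <= j)%N k j); try lia.
    rewrite -(avg_first R (x := j) ul); try (rewrite ?memP /P; lia).
    apply: le_in_avg => s sl'; rewrite /phi ik1 /first.
    have -> : filter (fun z => k <= z <= k)%N s = filter (pred1 k) s.
      by apply: eq_filter => z /=; lia.
    rewrite filter_pred1_uniq ?(perm_uniq sl') ?(perm_mem sl') ?memP /P; try lia.
    by rewrite /= eqxx mul1r.
  by [].
have [jk1|jkn] := eqVneq j k.
  rewrite jk1 subSnn invr1 mulr1 -(count_l (fun z => i <= z <= k)%N i k); try lia.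
    rewrite -(avg_first R (x := i) ul); try (rewrite ?memP /P; lia).
    apply: le_in_avg => s sl'; rewrite /phi jk1 /first.
    have -> : filter (fun z => k <= z <= k)%N s = filter (pred1 k) s.
      by apply: eq_filter => z /=; lia.
    rewrite filter_pred1_uniq ?(perm_uniq sl') ?(perm_mem sl') ?memP /P; try lia.
    by rewrite /= eqxx mulr1.
  by [].
have il : i \in l by rewrite memP /P; lia.
have jl : j \in l by rewrite memP /P; lia.
have phi_i s : phi (i :: s) = (first (fun z => k <= z <= j)%N j s)%:R.
  rewrite /phi /first /= (_ : i <= i <= k)%N; last lia.
  rewrite (_ : (k <= i <= j)%N = false); last lia.
  by rewrite /= eqxx mul1r.
have phi_j s : phi (j :: s) = (first (fun z => i <= z <= k)%N i s)%:R.
  rewrite /phi /first /= (_ : k <= j <= j)%N; last lia.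
  rewrite (_ : (i <= j <= k)%N = false); last lia.
  by rewrite /= eqxx mulr1.
rewrite avg_cons //; last by case: (l) il.
rewrite (big_rem i) //= (big_rem j) /=; last first.
  by rewrite mem_rem_uniq // inE jl andbT; move: ikn jkn; lia.
rewrite (eq_avg _ phi_i) (eq_avg _ phi_j).
rewrite (pre1 k j i); try lia; rewrite ?(pre1 i k j) //; try lia.
set S := \sum_(y <- _) _.
have S0 : 0 <= S.
  by apply: sumr_ge0 => x _; apply: avg_ge0 => s; rewrite mulr_ge0.
rewrite sl; have -> : (j.+1 - i = (k.+1 - i) + (j.+1 - k) - 1)%N by lia.
have : (1 <= k.+1 - i)%N by lia.
have : (1 <= j.+1 - k)%N by lia.
move: (k.+1 - i)%N (j.+1 - k)%N => a b b1 a1.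
rewrite natrB ?(leq_trans a1) ?leq_addr // natrD.
have {}a1 : 1 <= a%:R :> R by rewrite ler1n.
have {}b1 : 1 <= b%:R :> R by rewrite ler1n.
have ab : 0 < a%:R + b%:R - 1 :> R by lra.
rewrite ler_pdivlMr // addrA; apply: le_trans (_ : b%:R^-1 + a%:R^-1 <= _);
  last by rewrite lerDl.
rewrite mulrBr mulr1 -invfM.
have -> : (a%:R * b%:R)^-1 * (a%:R + b%:R) = b%:R^-1 + a%:R^-1 :> R.
  by field; rewrite !gt_eqF //; lra.
by rewrite gerBl invr_ge0 mulr_ge0.
Qed.

(** The number of ancestors of [k] has at least the variance of a sum of
    independent variables, since left and right ancestors are positively
    correlated. *)
Lemma variance_depth_ge n k : (1 <= k <= n)%N ->
  bvar (invs R k) + bvar (invs R (n - k).+1) <=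
  avg (iota 1 n) (fun s => ((depth k (bst s))%:R -
     avg (iota 1 n) (fun s => (depth k (bst s))%:R)) ^+ 2).
Proof.
move=> kn; pose l := iota 1 n; rewrite -/l.
have ul : uniq l by rewrite iota_uniq.
pose A i s : R := (first (fun z => i <= z <= k)%N i s)%:R.
pose B j s : R := (first (fun z => k <= z <= j)%N j s)%:R.
pose lA := iota 1 k; pose lB := iota k (n - k).+1.
pose X s := \sum_(i <- lA) A i s; pose Y s := \sum_(j <- lB) B j s.
have XE s : X s = (reccount lA (filter (mem lA) s))%:R.
  rewrite reccount_iota natr_sum; apply: eq_bigr => i _; rewrite /A.
  by congr (nat_of_bool _)%:R; congr (ohead _ == _); apply: eq_filter => z; lia.
have YE s : Y s = (reccount (rev lB) (filter (mem lB) s))%:R.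
  by rewrite reccount_rev_iota natr_sum.
have lawX (g : R -> R) : avg l (fun s => g (X s)) =
    bern (invs R k) (fun x => g x%:R).
  under eq_avg do rewrite XE.
  rewrite (avg_filter _ (fun s => g (reccount lA s)%:R)) //.
  rewrite (perm_avg _ (_ : perm_eq _ lA)); last first.
    apply: uniq_perm; rewrite ?filter_uniq ?iota_uniq // => z.
    by rewrite mem_filter /= !mem_iota; lia.
  rewrite (avg_reccount (fun m => g m%:R)) ?iota_uniq //.
  by rewrite size_iota.
have lawY (g : R -> R) : avg l (fun s => g (Y s)) =
    bern (invs R (n - k).+1) (fun x => g x%:R).
  under eq_avg do rewrite YE.
  rewrite (avg_filter _ (fun s => g (reccount (rev lB) s)%:R)) //.
  rewrite (perm_avg _ (_ : perm_eq _ (rev lB))); last first.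
    apply: uniq_perm; rewrite ?filter_uniq ?rev_uniq ?iota_uniq // => z.
    by rewrite mem_filter mem_rev /= !mem_iota; lia.
  rewrite (avg_reccount (fun m => g m%:R)) ?rev_uniq ?iota_uniq //.
  by rewrite size_rev size_iota.
(* Both sums count [k] itself. *)
have depthE s : perm_eq s l -> (depth k (bst s))%:R = X s + Y s - 2.
  move=> sl; rewrite (depth_bst sl) // natr_sum big_iota_neq //.
  have us : uniq s by rewrite (perm_uniq sl).
  have ks : k \in s by rewrite (perm_mem sl) mem_iota1.
  have fk : first (fun z => k <= z <= k)%N k s.
    rewrite /first; have -> : filter (fun z => k <= z <= k)%N s = filter (pred1 k) s.
      by apply: eq_filter => z /=; lia.
    by rewrite filter_pred1_uniq.
  have lAE : lA = rcons (iota 1 k.-1) k.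
    have kE : k = (k.-1 + 1)%N by lia.
    by rewrite /lA {1}kE iotaD /= cats1; congr rcons; lia.
  rewrite /X /Y lAE /lB big_rcons /= big_cons /A /B fk.
  have -> : \sum_(j <- iota 1 k.-1) (ancestor k j s)%:R =
      \sum_(i <- iota 1 k.-1) (first (fun z => i <= z <= k)%N i s)%:R :> R.
    apply: eq_big_seq => j; rewrite mem_iota => jk.
    rewrite /ancestor /first; congr (nat_of_bool (ohead _ == _))%:R.
    by apply: eq_filter => z; rewrite /between; lia.
  have -> : \sum_(j <- iota k.+1 (n - k)) (ancestor k j s)%:R =
      \sum_(j <- iota k.+1 (n - k)) (first (fun z => k <= z <= j)%N j s)%:R :> R.
    apply: eq_big_seq => j; rewrite mem_iota => jk.
    rewrite /ancestor /first; congr (nat_of_bool (ohead _ == _))%:R.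
    by apply: eq_filter => z; rewrite /between; lia.
  by rewrite mulr1n; lra.
have EX : avg l X = bmean (invs R k) by rewrite (lawX id) bern_mean.
have EY : avg l Y = bmean (invs R (n - k).+1) by rewrite (lawY id) bern_mean.
have VX : avg l (fun s => (X s - avg l X) ^+ 2) = bvar (invs R k).
  rewrite EX (lawX (fun x => (x - bmean (invs R k)) ^+ 2)) bern_var //.
  exact: probs_invs.
have VY : avg l (fun s => (Y s - avg l Y) ^+ 2) = bvar (invs R (n - k).+1).
  rewrite EY (lawY (fun x => (x - bmean (invs R (n - k).+1)) ^+ 2)) bern_var //.
  exact: probs_invs.
have ED : avg l (fun s => (depth k (bst s))%:R) = avg l X + avg l Y - 2.
  by rewrite (eq_in_avg depthE) avgB avgD avg_cst.
have cov : avg l X * avg l Y <= avg l (fun s => X s * Y s).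
  have -> : avg l X * avg l Y =
      \sum_(i <- lA) \sum_(j <- lB) avg l (A i) * avg l (B j).
    by rewrite !avg_sum mulr_suml; under eq_bigr do rewrite mulr_sumr.
  have -> : avg l (fun s => X s * Y s) =
      \sum_(i <- lA) \sum_(j <- lB) avg l (fun s => A i s * B j s).
    rewrite (eq_avg _ (psi := fun s => \sum_(i <- lA) \sum_(j <- lB) A i s * B j s)).
      by rewrite avg_sum; apply: eq_bigr => i _; rewrite avg_sum.
    by move=> s; rewrite mulr_suml; apply: eq_bigr => i _; rewrite mulr_sumr.
  rewrite big_seq [leRHS]big_seq; apply: ler_sum => i; rewrite mem_iota => ik.
  rewrite big_seq [leRHS]big_seq; apply: ler_sum => j; rewrite mem_iota => jk.
  rewrite !avg_first ?mem_iota1 //; try lia.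
  rewrite (@count_iota1 n _ i k) ?(@count_iota1 n _ k j) //; try lia.
  by apply: avg_first2; lia.
rewrite -VX -VY ED.
rewrite [leRHS](_ : _ = avg l (fun s => (X s - avg l X) ^+ 2) +
   avg l (fun s => (Y s - avg l Y) ^+ 2) +
   2 * (avg l (fun s => X s * Y s) - avg l X * avg l Y)); first by lra.
set a := avg l X; set b := avg l Y.
rewrite (eq_in_avg (psi := fun s => (X s - a) ^+ 2 + (Y s - b) ^+ 2 +
   2 * (X s * Y s - a * Y s - b * X s + a * b))); last first.
  by move=> s /depthE ->; ring.
rewrite !avgD avgZ avgD !avgB avg_cst // !avgZ -/a -/b; ring.
Qed.

End Ancestors.

(** * Expectations over a uniformly random permutation *)

Local Open Scope classical_set_scope.
Local Open Scope ring_scope.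

Section UniformPermutation.
Variables (R : realType) (n : nat).

Lemma uniform_perm_set1 (s : 'S_n) :
  uniform_perm n R [set s] = (n`!%:R^-1)%:E.
Proof.
rewrite /uniform_perm /mscale /= /counting asboolT; last exact: finite_set1.
by rewrite fset_set1 cardfs1 mule1.
Qed.

Lemma expectation_uniform_perm (f : 'S_n -> R) :
  ('E_(uniform_perm n R)[f] = (n`!%:R^-1 * \sum_(s : 'S_n) f s)%:E)%E.
Proof.
rewrite unlock.
rewrite (eq_integral (fun x => (\sum_(s : 'S_n) (f s)%:E * (\1_[set s] x)%:E)%E)).
  rewrite integral_sum //; last first.
    move=> s; apply: integrableZl => //.
    exact: integrable_indic.
  rewrite mulr_sumr -sumEFin; apply: eq_bigr => s _.
  rewrite integralZl //; last first.
    exact: integrable_indic.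
  rewrite integral_indic // setIT mulrC EFinM.
  by congr (_ * _)%E; exact: uniform_perm_set1.
move=> x _; rewrite sumEFin (bigD1 x) //= big1 ?addr0.
  by rewrite indicE mem_set // mulr1.
move=> s sx; rewrite indicE memNset ?mulr0 //=.
by apply/nesym/eqP.
Qed.

(** The list of keys of a uniformly random permutation is a uniformly random
    ordering of 1, ..., n. *)
Lemma perm_keys_uniform : perm_eq [seq perm_keys s | s <- enum {: 'S_n}]
  (permutations (iota 1 n)).
Proof.
have inj : injective (@perm_keys n).
  move=> s t /eq_in_map st; apply/permP => i.
  by apply/val_inj/succn_inj/st; rewrite mem_enum.
have keys s : perm_eq (@perm_keys n s) (iota 1 n).
  apply: uniq_perm; rewrite ?iota_uniq //.
    rewrite map_inj_uniq ?enum_uniq // => i j [] /val_inj /perm_inj //.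
  move=> k; rewrite mem_iota add1n ltnS; apply/mapP/idP => [[i _ ->]|].
    by rewrite ltn_ord.
  case: k => // k /= kn; exists ((s^-1)%g (Ordinal kn)); rewrite ?mem_enum //.
  by rewrite permKV.
have u1 : uniq [seq perm_keys s | s <- enum {: 'S_n}].
  by rewrite map_inj_uniq ?enum_uniq.
apply: uniq_perm; rewrite ?permutations_uniq //.
have [||_ h] := @uniq_min_size _ [seq perm_keys s | s <- enum {: 'S_n}]
  (permutations (iota 1 n)) u1; last exact: h.
- by move=> t /mapP[s _ ->]; rewrite mem_permutations.
- by rewrite size_permutations ?iota_uniq // size_iota size_map -cardE card_Sn.
Qed.

Lemma expectation_perm_keys (phi : seq nat -> R) :
  ('E_(uniform_perm n R)[(fun s => phi (perm_keys s))%R] =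
  (avg (iota 1 n) phi)%:E)%E.
Proof.
rewrite expectation_uniform_perm /avg size_iota mulrC.
rewrite -(perm_big _ perm_keys_uniform) big_map /=.
by rewrite -[in LHS]big_enum.
Qed.

End UniformPermutation.

(** * Stein's method for the normal distribution *)

Section Gaussian.
Variable R : realType.
Local Notation mu := (@lebesgue_measure R).

(** The standard normal density. *)
Definition gauss : R -> R := normal_pdf 0 1.

Lemma gaussE x : gauss x = normal_peak 1 * expR (- x ^+ 2 / 2).
Proof.
by rewrite /gauss normal_pdfE ?oner_eq0 // /normal_fun subr0 expr1n.
Qed.

Lemma gauss_gt0 x : 0 < gauss x.
Proof. by rewrite gaussE mulr_gt0 ?expR_gt0 // normal_peak_gt0 ?oner_eq0. Qed.

Lemma gaussN x : gauss (- x) = gauss x.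
Proof. by rewrite !gaussE sqrrN. Qed.

Lemma continuous_gauss : continuous gauss.
Proof. exact/continuous_normal_pdf/oner_neq0. Qed.

Lemma integrable_gauss : mu.-integrable setT (EFin \o gauss).
Proof. exact/integrable_normal_pdf. Qed.

Lemma is_derive_gauss (x : R) : is_derive x 1 gauss (- (x * gauss x)).
Proof.
rewrite gaussE (_ : gauss = normal_peak 1 *: (expR \o (fun x : R => - x ^+ 2 / 2))); last first.
  by apply/funext => y; rewrite gaussE.
apply: is_derive_eq.
by rewrite /= /GRing.scale /=; field.
Qed.

Lemma cvg_gauss : gauss x @[x --> +oo] --> (0 : R).
Proof.
rewrite -(mulr0 (normal_peak 1)); under eq_cvg do rewrite gaussE mulNr.
apply: cvgM; first exact: cvg_cst.
apply: (cvg_comp (fun x : R => x ^+ 2 / 2) (fun x => expR (- x))).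
  by apply: gt0_cvgMly; rewrite ?invr_gt0 //; exact: cvgr_expr2.
exact: cvgr_expR.
Qed.

Lemma integral_normal_prob (f : R -> R) (M : R) :
  measurable_fun setT f -> (forall x, `|f x| <= M) ->
  (\int[normal_prob 0 1]_x (f x)%:E = \int[mu]_x (f x * gauss x)%:E)%E.
Proof.
move=> mf fM.
have dom := normal_prob_dominates (0 : R) 1.
have mg := measurable_normal_pdf (0 : R) 1.
rewrite -(Radon_Nikodym_change_of_variables dom) //; last first.
  apply: measurable_bounded_integrable => //.
    by rewrite (le_lt_trans (probability_le1 _ _)) // ltry.
  exists M; split; first exact: num_real.
  by move=> y My x _; rewrite /= (le_trans (fM x)) // ltW.
apply: ae_eq_integral => //.
- apply: emeasurable_funM; first exact/measurable_EFinP.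
  by apply: (measurable_int mu); exact: Radon_Nikodym_integrable.
- by apply/measurable_EFinP/measurable_funM.
- under [X in ae_eq _ _ _ X]eq_fun do rewrite EFinM.
  apply: ae_eqe_mul2l => /=.
  rewrite Radon_NikodymE //=.
  case: cid => /= h [h1 h2 h3].
  apply: integral_ae_eq => //=.
  + by apply/measurable_EFinP.
  + by move=> E E01 mE; rewrite -h3.
Qed.

(** The opposite of the density is a primitive of t times the density. *)
Lemma integral_gauss_tail (a : R) : 0 <= a ->
  (\int[mu]_(t in `[a, +oo[) (t * gauss t)%:E = (gauss a)%:E)%E.
Proof.
move=> a0; rewrite (@ge0_continuous_FTC2y _ _ (fun x => - gauss x) _ 0).
- by rewrite -EFinD opprK add0r.
- move=> x ax; apply: mulr_ge0; first exact: le_trans ax.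
  exact/ltW/gauss_gt0.
- apply: continuous_subspaceT => x; apply: cvgM; first exact: cvg_id.
  exact: continuous_gauss.
- rewrite -oppr0; apply: cvgN; exact: cvg_gauss.
- by move=> x _; apply: derivableN; case: (is_derive_gauss x).
- apply: cvg_at_right_filter; apply: cvgN; exact: continuous_gauss.
- move=> x _; rewrite derive1E deriveN; last by case: (is_derive_gauss x).
  by rewrite (@derive_val _ _ _ _ _ _ _ (is_derive_gauss x)) opprK.
Qed.

Lemma measurable_gauss : measurable_fun setT gauss.
Proof. exact: measurable_normal_pdf. Qed.

Lemma integrable_gauss_on D : measurable D -> mu.-integrable D (EFin \o gauss).
Proof. by move=> mD; apply: integrableS integrable_gauss. Qed.

Lemma integrableZ_gauss D (k : R) : measurable D ->
  mu.-integrable D (EFin \o (fun x => k * gauss x)).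
Proof.
move=> mD; rewrite (_ : EFin \o _ = (fun x => k%:E * (EFin \o gauss) x)%E).
  by apply: integrableZl => //; exact: integrable_gauss_on.
by apply/funext => x /=; rewrite EFinM.
Qed.

(** On the half-line from [a], the density is at most t/a times itself, and
    t times the density integrates to its value at [a]. *)
Lemma gauss_tail_le (a : R) : 0 <= a ->
  a * \int[mu]_(t in `[a, +oo[) gauss t <= gauss a.
Proof.
move=> a0; rewrite -RintegralZl //; last exact: integrable_gauss_on.
rewrite -lee_fin /Rintegral fineK; last first.
  by apply: integrable_fin_num => //; exact: integrableZ_gauss.
rewrite -integral_gauss_tail //; apply: ge0_le_integral => //.
- by move=> t _; rewrite lee_fin mulr_ge0 // ltW // gauss_gt0.
- apply/measurable_EFinP/measurable_funTS/measurable_funM => //.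
  exact: measurable_gauss.
- apply/measurable_EFinP/measurable_funTS/measurable_funM => //.
  exact: measurable_gauss.
- move=> t /=; rewrite in_itv /= andbT => at_; rewrite lee_fin ler_wpM2r //.
  exact/ltW/gauss_gt0.
Qed.

Lemma gauss_left_tail (a : R) :
  \int[mu]_(t in `]-oo, - a]) gauss t = \int[mu]_(t in `[a, +oo[) gauss t.
Proof.
rewrite /Rintegral ge0_integration_by_substitutionNy.
- by congr fine; apply: eq_integral => x _ /=; rewrite gaussN.
- by apply: continuous_subspaceT; exact: continuous_gauss.
- by move=> x _; rewrite ltW // gauss_gt0.
Qed.

Lemma integral_gauss : \int[mu]_x gauss x = 1.
Proof. by rewrite /Rintegral integral_normal_pdf. Qed.

Lemma gauss_integral_le1 D : measurable D -> \int[mu]_(t in D) gauss t <= 1.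
Proof.
move=> mD; rewrite -integral_gauss Rintegral_mkcond.
apply: le_Rintegral => //.
- by rewrite -restrict_EFin; apply/(integrable_mkcond _ mD)/integrable_gauss_on.
- exact: integrable_gauss.
- move=> x _; rewrite patchE; case: ifP => // _.
  exact/ltW/gauss_gt0.
Qed.

(** The expectation of [h] under the standard normal law. *)
Definition gauss_mean (h : R -> R) : R := \int[normal_prob 0 1]_x h x.

Section SteinEquation.
Variables (h : R -> R) (B : R).
Hypothesis hB : forall x, `|h x| <= B.
Hypothesis ch : continuous h.

Let mh : measurable_fun setT h.
Proof. exact: continuous_measurable_fun. Qed.

Let B0 : 0 <= B.
Proof. exact: le_trans (hB 0). Qed.

Let c := gauss_mean h.

Lemma integrable_mul_gauss (f : R -> R) (M : R) : measurable_fun setT f ->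
  (forall x, `|f x| <= M) -> mu.-integrable setT (EFin \o (f \* gauss)).
Proof.
move=> mf fM.
have mD := @measurableT _ (measurableTypeR R).
apply: (le_integrable mD _ _ (integrableZ_gauss M mD)).
- apply/measurable_EFinP/measurable_funM => //; exact: measurable_gauss.
- move=> x _; rewrite /= lee_fin !normrM ler_wpM2r //.
  by rewrite (le_trans (fM x)) // ler_norm.
Qed.

Lemma gauss_meanE : c = \int[mu]_x (h x * gauss x).
Proof. by rewrite /c /gauss_mean /Rintegral (integral_normal_prob mh hB). Qed.

Lemma gauss_mean_le : `|c| <= B.
Proof.
rewrite gauss_meanE; apply: le_trans (le_normr_Rintegral _ _) _ => //.
  exact: integrable_mul_gauss mh hB.
rewrite -[leRHS]mulr1 -integral_gauss -RintegralZl //; last exact: integrable_gauss.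
apply: le_Rintegral => //.
- rewrite (_ : EFin \o _ = abse \o (EFin \o (h \* gauss))); last first.
    by apply/funext.
  by apply/integrable_abse; exact: integrable_mul_gauss mh hB.
- exact: integrableZ_gauss.
- move=> x _; rewrite normrM ler_pM // ger0_norm // ltW //; exact: gauss_gt0.
Qed.

Let w x := (h x - c) * gauss x.

Let w_le x : `|h x - c| <= 2 * B.
Proof.
by rewrite (le_trans (ler_normB _ _)) // mulr_natl mulr2n lerD // gauss_mean_le.
Qed.

Let iw D : measurable D -> mu.-integrable D (EFin \o w).
Proof.
move=> mD; apply: (@integrableS _ _ _ mu setT) => //.
apply: (integrable_mul_gauss (M := 2 * B)); last exact: w_le.
exact: measurable_funB.
Qed.

Let K x := \int[mu]_(t in `]-oo, x]) w t.

Let is_derive_K (x : R) : is_derive x 1 K (w x).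
Proof.
have xx1 : x < x + 1 by rewrite ltrDl.
have cw : {for x, continuous w}.
  apply: cvgM; last exact: continuous_gauss.
  by apply: cvgB; [exact: ch | exact: cvg_cst].
have [|dK K'] := continuous_FTC1 xx1 (iw (measurable_itv `]-oo, x + 1])) _ cw.
  by rewrite ltNyr.
by apply: DeriveDef; [exact: dK | rewrite -derive1E; exact: K'].
Qed.

Let integral_w : \int[mu]_x w x = 0.
Proof.
rewrite /w; under eq_Rintegral do rewrite mulrBl.
rewrite RintegralB //; last 2 first.
- exact: integrable_mul_gauss mh hB.
- exact: integrableZ_gauss.
rewrite -gauss_meanE RintegralZl //; last exact: integrable_gauss.
by rewrite integral_gauss mulr1 subrr.
Qed.

Let KE x : K x = - \int[mu]_(t in `[x, +oo[) w t.
Proof.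
have := Rintegral_itvB (x := x) (iw (measurable_itv `]-oo, +oo[)) isT isT.
rewrite set_itvNyy integral_w sub0r => KN.
rewrite -Rintegral_itv_obnd_cbnd -?KN ?opprK //; exact: iw.
Qed.

Let norm_integral_w D : measurable D ->
  `|\int[mu]_(t in D) w t| <= 2 * B * \int[mu]_(t in D) gauss t.
Proof.
move=> mD; apply: le_trans (le_normr_Rintegral mD (iw mD)) _.
rewrite -RintegralZl //; last exact: integrable_gauss_on.
apply: le_Rintegral => //.
- rewrite (_ : EFin \o _ = abse \o (EFin \o w)); last by apply/funext.
  by apply/integrable_abse; exact: iw.
- exact: integrableZ_gauss.
- move=> x _; rewrite normrM (@ger0_norm _ (gauss x)) ?ler_wpM2r //;
    exact/ltW/gauss_gt0.
Qed.

(** A bounded solution of Stein's equation, with bounded derivative. The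
    solution is K / gauss, where K is the primitive of (h - c) gauss vanishing
    at both infinities; the tail estimate is used on the left of 0 or on its
    right, according to the sign of x. *)
Lemma stein_solution : exists f : R -> R, [/\
  forall x : R, is_derive x 1 f (x * f x + (h x - c)),
  forall x, `|x * f x| <= 2 * B &
  forall x, `|f x| <= 2 * B * (1 + (gauss 1)^-1)].
Proof.
pose f x := K x / gauss x.
have g0 := gauss_gt0.
have gn0 x : gauss x != 0 by rewrite gt_eqF.
have B20 : 0 <= 2 * B by rewrite mulr_ge0.
have bound (x a : R) : 0 <= a -> `|K x| <= 2 * B * \int[mu]_(t in `[a, +oo[) gauss t ->
    gauss a = gauss x -> a * `|f x| <= 2 * B.
  move=> a0 Kx ga; rewrite normrM normfV (gtr0_norm (g0 x)) mulrA ler_pdivrMr //.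
  rewrite -ga; apply: le_trans (_ : 2 * B * (a * \int[mu]_(t in `[a, +oo[) gauss t) <= _).
    by rewrite mulrCA ler_wpM2l.
  by rewrite ler_wpM2l // gauss_tail_le.
have xf (x : R) : `|x * f x| <= 2 * B.
  rewrite normrM; apply: bound => //.
    have [x0|x0] := leP 0 x.
      by rewrite (ger0_norm x0) KE normrN norm_integral_w.
    by rewrite (ltr0_norm x0) -gauss_left_tail opprK norm_integral_w.
  by have [x0|x0] := leP 0 x; rewrite ?(ger0_norm x0) // (ltr0_norm x0) gaussN.
exists f; split => //.
  move=> x.
  have dK := is_derive_K x; have dg := is_derive_gauss x.
  have dV := is_deriveV (gn0 x) dg.
  have := is_deriveM dK dV; rewrite /GRing.scale /=.
  set d := (X in is_derive _ _ _ X -> _) => fd.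
  have -> : x * f x + (h x - c) = d by rewrite /d /f /w; field; exact: gn0.
  exact: fd.
move=> x; have [x1|x1] := leP 1 `|x|.
  apply: le_trans (_ : 2 * B * 1 <= _).
    by rewrite mulr1; apply: le_trans (xf x); rewrite (normrM x) ler_peMl.
  by rewrite ler_wpM2l // lerDl invr_ge0 ltW.
rewrite normrM normfV (gtr0_norm (g0 x)).
apply: le_trans (_ : 2 * B * (gauss 1)^-1 <= _); last first.
  by rewrite ler_wpM2l // lerDr.
apply: ler_pM => //.
- by rewrite invr_ge0 ltW.
- rewrite (le_trans (norm_integral_w _)) // -[leRHS]mulr1 ler_wpM2l //.
  exact: gauss_integral_le1.
- rewrite lef_pV2 ?posrE // !gaussE ler_wpM2l ?normal_peak_ge0 // ler_expR.
  rewrite ler_pM2r ?invr_gt0 // lerN2 expr1n.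
  by rewrite -real_normK ?num_real // expr_le1 // ltW.
Qed.

End SteinEquation.
End Gaussian.

(** * Normal approximation for sums of independent Bernoulli variables *)

Section NormalApproximation.
Variable R : realType.
Implicit Types (ps : seq R) (h : R -> R).

(** [h] is bounded by [B] and [L]-Lipschitz. *)
Definition lipschitz_bounded (B L : R) h : Prop :=
  (forall x, `|h x| <= B) /\ (forall x y, `|h x - h y| <= L * `|x - y|).

Lemma lipschitz_continuous (L : R) h :
  (forall x y, `|h x - h y| <= L * `|x - y|) -> continuous h.
Proof.
move=> hL x; apply/cvgrPdist_le => e e0.
have L1 : 0 < `|L| + 1 by rewrite ltr_wpDl.
near=> y; apply: le_trans (hL x y) _.
apply: le_trans (_ : (`|L| + 1) * `|x - y| <= _).
  by rewrite ler_wpM2r // (le_trans (ler_norm L)) // lerDl.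
rewrite -ler_pdivlMl //; near: y; apply: cvgr_dist_le => //.
by rewrite mulr_gt0 ?invr_gt0.
Unshelve. all: by end_near. Qed.

Lemma is_derive_lipschitz (f df : R -> R) (M : R) :
  (forall x : R, is_derive x 1 f (df x)) -> (forall x, `|df x| <= M) ->
  forall x y, `|f x - f y| <= M * `|x - y|.
Proof.
move=> fdf dfM; have cf : continuous f.
  move=> x; apply: differentiable_continuous; apply/derivable1_diffP.
  by case: (fdf x).
have main x y : x < y -> `|f x - f y| <= M * `|x - y|.
  move=> xy.
  have [c _ E] := MVT xy (fun z _ => fdf z) (continuous_subspaceT cf).
  by rewrite distrC E normrM (distrC x) ler_wpM2r.
move=> x y; case: (ltgtP x y) => [|yx|->]; first exact: main.
  by rewrite distrC (distrC x); exact: main.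
by rewrite !subrr !normr0 mulr0.
Qed.

(** The error in [bern_gauss] is this constant over the standard deviation. *)
Definition stein_const (B L : R) : R := 2 * B * (3 + (gauss 1)^-1) + L.

(** The normal approximation in bounded-Lipschitz distance, with an explicit
    rate: the reciprocal of the standard deviation. *)
Lemma bern_gauss ps h (B L : R) : probs ps -> 0 < bvar ps ->
  lipschitz_bounded B L h ->
  `|bern ps (fun k => h ((k%:R - bmean ps) / Num.sqrt (bvar ps))) -
    gauss_mean h| <= stein_const B L / Num.sqrt (bvar ps).
Proof.
move=> hps v0 [hB hL]; set s := Num.sqrt (bvar ps); set m := bmean ps.
have s0 : 0 < s by rewrite sqrtr_gt0.
have sE : bvar ps = s ^+ 2 by rewrite sqr_sqrtr // ltW.
have B0 : 0 <= B by exact: le_trans (hB 0).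
have L0 : 0 <= L.
  by have := hL 1 0; rewrite subr0 normr1 mulr1; exact: le_trans.
have [f [df xf fB]] := stein_solution hB (lipschitz_continuous hL).
set c := gauss_mean h in df *.
pose f' x := x * f x + (h x - c).
have f'B x : `|f' x| <= 4 * B.
  rewrite (le_trans (ler_normD _ _)) //.
  have := xf x; have : `|h x - c| <= 2 * B; last by lra.
  rewrite (le_trans (ler_normB _ _)) // mulr_natl mulr2n lerD //.
  exact: gauss_mean_le hB (lipschitz_continuous hL).
have fL := is_derive_lipschitz df f'B.
pose C := 2 * B * (1 + (gauss 1)^-1) + L.
have f'L y z : `|f' y - f' z| <= `|y - z| * (4 * B * `|y| + C).
  have -> : f' y - f' z = y * (f y - f z) + (y - z) * f z + (h y - h z).
    by rewrite /f'; ring.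
  rewrite (le_trans (ler_normD _ _)) //.
  have := ler_normD (y * (f y - f z)) ((y - z) * f z); rewrite !normrM.
  have := ler_wpM2l (normr_ge0 y) (fL y z).
  have := ler_wpM2l (normr_ge0 (y - z)) (fB z).
  have := hL y z; rewrite /C; lra.
pose w (k : nat) := (k%:R - m) / s.
have wS k : w k.+1 - w k = s^-1 by rewrite /w -natr1; field; rewrite gt_eqF.
pose e k := s^-1 ^+ 2 * (4 * B * `|w k| + C).
(* The increment of f between two consecutive values is f' at an intermediate
   point divided by s, close to f' at both ends. *)
have near_f' k y : `|y - w k| <= s^-1 -> `|s^-1 * f' y - s^-1 * f' (w k)| <= e k.
  move=> yk; rewrite -mulrBr normrM gtr0_norm ?invr_gt0 // /e expr2 -mulrA.
  rewrite ler_wpM2l ?invr_ge0 ?(ltW s0) // (distrC (f' y)).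
  rewrite (le_trans (f'L _ _)) // distrC ler_wpM2r //.
  by rewrite !addr_ge0 ?mulr_ge0 ?addr_ge0 ?invr_ge0 ?(ltW (gauss_gt0 _)).
have dg k : exists2 y, w k < y < w k.+1 & f (w k.+1) - f (w k) = s^-1 * f' y.
  have wk : w k < w k.+1 by rewrite -subr_gt0 wS invr_gt0.
  have cf : continuous f.
    by move=> z; apply: differentiable_continuous; apply/derivable1_diffP; case: (df z).
  have [y yk E] := MVT wk (fun z _ => df z) (continuous_subspaceT cf).
  by exists y; rewrite ?(itvP yk) // E wS mulrC.
have H1 k : `|(f \o w) k.+1 - (f \o w) k - s^-1 * f' (w k)| <= e k.
  rewrite /=; have [y /andP[y1 y2] ->] := dg k; apply: near_f'.
  by rewrite ger0_norm ?subr_ge0 ?(ltW y1) // -(wS k) lerD2r ltW.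
have H2 k : `|(f \o w) k.+1 - (f \o w) k - s^-1 * f' (w k.+1)| <= e k.+1.
  rewrite /=; have [y /andP[y1 y2] ->] := dg k; apply: near_f'.
  by rewrite ler0_norm ?subr_le0 ?(ltW y2) // opprB -(wS k) lerD2l lerN2 ltW.
have := bern_stein (G := fun k => s^-1 * f' (w k)) hps H1 H2.
rewrite -/m sE.
have -> : bern ps e = s^-1 ^+ 2 * (4 * B * bern ps (fun k => `|w k|) + C).
  by rewrite /e bernZ (bernD ps (fun k => 4 * B * `|w k|)) bern_cst bernZ.
rewrite bernZ.
have -> : bern ps (fun k => (k%:R - m) * (f \o w) k) =
    s * bern ps (fun k => w k * f (w k)).
  by rewrite -bernZ; apply: eq_bern => k; rewrite /w /=; field; rewrite gt_eqF.
have -> : s * bern ps (fun k => w k * f (w k)) -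
    s ^+ 2 * (s^-1 * bern ps (fun k => f' (w k))) =
    - s * (bern ps (fun k => h (w k)) - c).
  have -> : s ^+ 2 * (s^-1 * bern ps (fun k => f' (w k))) =
    s * bern ps (fun k => f' (w k)) by field; rewrite gt_eqF.
  by rewrite /f' bernD bernB bern_cst; ring.
have -> : s ^+ 2 * (s^-1 ^+ 2 * (4 * B * bern ps (fun k => `|w k|) + C)) =
  4 * B * bern ps (fun k => `|w k|) + C by field; rewrite gt_eqF.
rewrite normrM normrN (gtr0_norm s0) => H.
have Ew : bern ps (fun k => `|w k|) <= 1.
  apply: le_trans (_ : bern ps (fun k => 2^-1 * (1 + (s^-1) ^+ 2 * (k%:R - m) ^+ 2)) <= _).
    apply: le_bern => // k; have : 0 <= (`|w k| - 1) ^+ 2 by exact: sqr_ge0.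
    by rewrite -exprMn (mulrC s^-1) -/(w k) -(real_normK (num_real (w k))); lra.
  rewrite bernZ bernD bern_cst bernZ bern_var // sE -exprMn mulVf ?gt_eqF //.
  by rewrite expr1n; lra.
rewrite ler_pdivlMr // mulrC; apply: le_trans H _.
have := ler_wpM2l (_ : 0 <= 4 * B) Ew; rewrite /stein_const /C.
by rewrite mulr_ge0 // => /(_ isT); lra.
Qed.

End NormalApproximation.

(** * Harmonic sums *)

Section Harmonic.
Variable R : realType.

Lemma bmean_cat (ps1 ps2 : seq R) : bmean (ps1 ++ ps2) = bmean ps1 + bmean ps2.
Proof. exact: big_cat. Qed.

Lemma bvar_cat (ps1 ps2 : seq R) : bvar (ps1 ++ ps2) = bvar ps1 + bvar ps2.
Proof. exact: big_cat. Qed.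

Lemma bmean_invsS m : bmean (invs R m.+1) = m.+1%:R^-1 + bmean (invs R m).
Proof. exact: big_cons. Qed.

Lemma bvar_invsS m :
  bvar (invs R m.+1) = m.+1%:R^-1 * (1 - m.+1%:R^-1) + bvar (invs R m).
Proof. exact: big_cons. Qed.

Lemma ln_succ_sub m : (0 < m)%N ->
  m.+1%:R^-1 <= ln (m.+1%:R : R) - ln m%:R <= m%:R^-1.
Proof.
move=> m0; have m0' : 0 < m%:R :> R by rewrite ltr0n.
have mS0 : 0 < m.+1%:R :> R by rewrite ltr0n.
rewrite -ln_div ?posrE //; apply/andP; split.
  have -> : m.+1%:R / m%:R = (m%:R / m.+1%:R)^-1 :> R by rewrite invf_div.
  rewrite lnV ?posrE ?divr_gt0 // lerNr.
  have -> : m%:R / m.+1%:R = 1 + - m.+1%:R^-1 :> R.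
    by rewrite -natr1; field; rewrite natr1 gt_eqF.
  apply: le_ln1Dx; rewrite ltrN2 invf_lt1 // ltr1n.
  by rewrite ltnS.
have -> : m.+1%:R / m%:R = 1 + m%:R^-1 :> R.
  by rewrite -natr1; field; rewrite gt_eqF.
by apply: le_ln1Dx; rewrite (lt_le_trans (ltrN10 R)) // invr_ge0 ltW.
Qed.

Lemma harmonic_ge m : ln m.+1%:R <= bmean (invs R m).
Proof.
elim: m => [|m IH]; first by rewrite ln1 /bmean big_nil.
have /andP[_ h] := @ln_succ_sub m.+1 isT.
by rewrite bmean_invsS -[leLHS](subrK (ln m.+1%:R)) lerD.
Qed.

Lemma harmonic_le m n : (m <= n)%N -> (0 < n)%N ->
  bmean (invs R m) <= 1 + ln n%:R.
Proof.
move=> mn n0; case: m mn => [|m] mn.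
  by rewrite /bmean big_nil addr_ge0 // ln_ge0 // ler1n.
apply: le_trans (_ : 1 + ln m.+1%:R <= _); last first.
  by rewrite lerD2l ler_ln ?posrE ?ltr0n // ler_nat.
elim: m {n n0 mn} => [|m IH].
  by rewrite bmean_invsS ln1 /bmean big_nil invr1.
have /andP[h _] := @ln_succ_sub m.+1 isT.
by rewrite bmean_invsS (le_trans (lerD h IH)) // addrCA subrK.
Qed.

Lemma bvar_invs_ge m : bmean (invs R m) - 2 <= bvar (invs R m).
Proof.
case: m => [|m]; first by rewrite /bmean /bvar !big_nil; lra.
(* The sum of the 1/i^2 for 1 <= i <= m is at most 2 - 1/m. *)
suff : bmean (invs R m.+1) - 2 + m.+1%:R^-1 <= bvar (invs R m.+1).
  by apply: le_trans; rewrite lerDl invr_ge0.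
elim: m => [|m IH]; rewrite bmean_invsS bvar_invsS.
  by rewrite /bmean /bvar !big_nil invr1; lra.
have aux (x y a b : R) : x - 2 + a <= y -> b * b <= a - b ->
  b + x - 2 + b <= b * (1 - b) + y by lra.
apply: aux IH _.
have m1 : 0 < m.+1%:R :> R by rewrite ltr0n.
have m2 : 0 < m.+2%:R :> R by rewrite ltr0n.
have -> : m.+1%:R^-1 - m.+2%:R^-1 = m.+1%:R^-1 * m.+2%:R^-1 :> R.
  rewrite -[m.+2%:R]natr1; move: m.+1%:R m1 => x x0; field.
  by rewrite !gt_eqF // addr_gt0.
by rewrite ler_wpM2r ?invr_ge0 // lef_pV2 ?posrE // ler_nat.
Qed.

Lemma bvar_le_mean (ps : seq R) : probs ps -> bvar ps <= bmean ps.
Proof.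
move=> /allP h; rewrite /bvar /bmean big_seq [leRHS]big_seq.
apply: ler_sum => p /h /andP[p0 p1]; rewrite ler_piMr //.
by rewrite gerBl.
Qed.

(** The parameters of the Bernoulli variables whose sum is the number of
    ancestors of the key [k] when it is inserted last. *)
Definition depth_probs n k := invs R k.-1 ++ invs R (n - k).

Lemma probs_depth n k : probs (depth_probs n k).
Proof. by rewrite /probs all_cat; apply/andP; split; exact: probs_invs. Qed.

Lemma bmean_depth_ge n k : (1 <= k <= n)%N ->
  ln k%:R + ln (n - k).+1%:R <= bmean (depth_probs n k).
Proof.
move=> /andP[k1 kn]; rewrite bmean_cat lerD ?harmonic_ge //.
by rewrite -[in leLHS](prednK k1) harmonic_ge.
Qed.

(** The product k (n - k + 1) is at least n. *)
Lemma ln_mul_ge n k : (1 <= k <= n)%N ->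
  ln (n%:R : R) <= ln k%:R + ln (n - k).+1%:R.
Proof.
move=> /andP[k1 kn].
rewrite -lnM ?posrE ?ltr0n // -natrM ler_ln ?posrE ?ltr0n ?muln_gt0 ?k1 //.
  rewrite ler_nat; have := subnK kn; move: (n - k)%N => a <-.
  by rewrite mulnS mulnC; nia.
exact: leq_trans kn.
Qed.

Lemma bmean_depth_le n k : (1 <= k <= n)%N ->
  bmean (depth_probs n k) <= 2 + 2 * ln n%:R.
Proof.
move=> /andP[k1 kn]; have n0 : (0 < n)%N by exact: leq_trans kn.
rewrite bmean_cat.
have := @harmonic_le k.-1 n (leq_trans (leq_pred k) kn) n0.
have := @harmonic_le (n - k) n (leq_subr k n) n0; lra.
Qed.

Lemma bvar_depth_ge n k : bmean (depth_probs n k) - 4 <= bvar (depth_probs n k).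
Proof.
rewrite bmean_cat bvar_cat.
have := bvar_invs_ge k.-1; have := bvar_invs_ge (n - k); lra.
Qed.

Lemma bvar_depth_le n k : bvar (depth_probs n k) <= bmean (depth_probs n k).
Proof. exact/bvar_le_mean/probs_depth. Qed.

Lemma sum_harmonic n :
  \sum_(m <- iota 0 n) bmean (invs R m) = n%:R * bmean (invs R n) - n%:R.
Proof.
elim: n => [|n IH]; first by rewrite big_nil mul0r subrr.
rewrite -addn1 iotaD big_cat big_seq1 add0n IH addn1 bmean_invsS -natr1.
by rewrite /=; field; rewrite natr1 pnatr_eq0.
Qed.

Lemma sum_bmean_depth n : \sum_(k <- iota 1 n) bmean (depth_probs n k) =
  2 * (n%:R * bmean (invs R n) - n%:R).
Proof.
under eq_bigr do rewrite bmean_cat.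
rewrite big_split /= mulr_natl mulr2n -sum_harmonic; congr (_ + _).
  by rewrite (iotaDl 1 0) big_map.
have -> : iota 0 n = rev (map (fun k => n - k)%N (iota 1 n)).
  apply: (@eq_from_nth _ 0%N); rewrite ?size_rev ?size_map ?size_iota // => i ni.
  rewrite nth_iota // nth_rev ?size_map ?size_iota //.
  by rewrite (nth_map 0%N) ?size_iota ?nth_iota; lia.
by rewrite big_rev /= big_map.
Qed.

(** On average over [k], the mean depth of [k] inserted last is within 6 of
    2 log n. *)
Lemma avg_bmean_depth n : (0 < n)%N ->
  \sum_(k <- iota 1 n) `|bmean (depth_probs n k) - 2 * ln n%:R| <= 6 * n%:R.
Proof.
(* The mean is at most 2 + 2 log n: the absolute value can be removed. *)
move=> n0; apply: le_trans (_ : \sum_(k <- iota 1 n)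
  (4 + 2 * ln n%:R - bmean (depth_probs n k)) <= _).
  rewrite big_seq [leRHS]big_seq; apply: ler_sum => k; rewrite mem_iota1 => kn.
  have := bmean_depth_le kn; rewrite ler_norml => h.
  apply/andP; split; last by lra.
  by lra.
rewrite sumrB sum_bmean_depth sum_cst_seq size_iota.
have : ln n%:R <= bmean (invs R n).
  apply: le_trans (harmonic_ge n); rewrite ler_ln ?posrE ?ltr0n //.
  by rewrite ler_nat.
have : 0 < n%:R :> R by rewrite ltr0n.
by move=> m0 lb; have := ler_wpM2l (ltW m0) lb; lra.
Qed.

End Harmonic.


(** * Normal approximation for the depth of the last key *)

(** Here [l] is log n, [q] and [r] are the square roots of 2 log n and log n,
    [s] is the exact standard deviation of the depth of [k] inserted last, and
    [d] is the distance of its mean to 2 log n. The lower bound on log n ensures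
    that the variance is at least log n / 4. *)
Section DepthApproximation.
Variable R : realType.
Variables (n k : nat) (l q r d s : R).
Let ps := depth_probs R n k.
Hypothesis kn : (1 <= k <= n)%N.
Hypothesis lE : l = ln n%:R.
Hypothesis l8 : 8 <= l.
Hypothesis q_def : q = Num.sqrt (2 * l).
Hypothesis r_def : r = Num.sqrt l.
Hypothesis d_def : d = `|bmean ps - 2 * l|.
Hypothesis s_def : s = Num.sqrt (bvar ps).

Let l0 : 0 < l. Proof. by apply: lt_le_trans l8. Qed.
Let r0 : 0 < r. Proof. by rewrite r_def sqrtr_gt0. Qed.
Let q0 : 0 < q. Proof. by rewrite q_def sqrtr_gt0 mulr_gt0. Qed.
Let rE : r ^+ 2 = l. Proof. by rewrite r_def sqr_sqrtr // ltW. Qed.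
Let qE : q ^+ 2 = 2 * l.
Proof. by rewrite q_def sqr_sqrtr // mulr_ge0 // ltW. Qed.
Let r1 : 1 <= r.
Proof.
have : 1 ^+ 2 <= r ^+ 2 by rewrite rE expr1n; have := l8; lra.
by rewrite ler_sqr ?nnegrE ?(ltW r0).
Qed.
Let rq : r <= q.
Proof.
have : r ^+ 2 <= q ^+ 2 by rewrite rE qE; have := l0; lra.
by rewrite ler_sqr ?nnegrE ?(ltW r0) ?(ltW q0).
Qed.

Let v_ge : l / 4 <= bvar ps.
Proof.
have := bvar_depth_ge R n k; have := bmean_depth_ge R kn.
have := ln_mul_ge R kn; rewrite -lE -/ps; have := l8; lra.
Qed.

Let v0 : 0 < bvar ps.
Proof. by apply: lt_le_trans v_ge; rewrite divr_gt0. Qed.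
Let s0 : 0 < s. Proof. by rewrite s_def sqrtr_gt0. Qed.
Let sE : s ^+ 2 = bvar ps. Proof. by rewrite s_def sqr_sqrtr // ltW. Qed.

Let rs : r / 2 <= s.
Proof.
have : (r / 2) ^+ 2 <= s ^+ 2.
  by rewrite sE expr_div_n rE; apply: le_trans v_ge; lra.
by rewrite ler_sqr ?nnegrE ?(ltW s0) ?divr_ge0 ?(ltW r0).
Qed.

Let d0 : 0 <= d. Proof. by rewrite d_def normr_ge0. Qed.

Let sq_le : `|s / q - 1| <= (4 + d) / r.
Proof.
have -> : s / q - 1 = (bvar ps - 2 * l) / (q * (s + q)).
  by rewrite -sE -qE; field; rewrite !gt_eqF ?addr_gt0.
rewrite normrM normfV; apply: ler_pM => //.
  have h : `|bvar ps - bmean ps| <= 4.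
    rewrite distrC ger0_norm; last by rewrite subr_ge0 bvar_depth_le.
    by have := bvar_depth_ge R n k; rewrite -/ps; lra.
  by rewrite -(subrK (bmean ps) (bvar ps)) -addrA (le_trans (ler_normD _ _)) //
    d_def lerD.
have qs : 0 < q * (s + q) by rewrite mulr_gt0 ?addr_gt0.
rewrite lef_pV2 ?posrE ?normr_gt0 ?gt_eqF // gtr0_norm //.
have : 0 <= (q - 1) * (s + q).
  by rewrite mulr_ge0 ?subr_ge0 ?(le_trans r1 rq) // ltW ?addr_gt0.
by move: rq s0; lra.
Qed.

Let W (x : nat) : R := (x%:R - bmean ps) / s.
Let Z (x : nat) : R := (x%:R - 2 * l) / q.

Let EW : bern ps (fun x => `|W x|) <= 1.
Proof.
apply: le_trans (_ : bern ps (fun x => 2^-1 * (1 + s^-1 ^+ 2 *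
    (x%:R - bmean ps) ^+ 2)) <= _).
  apply: le_bern => [|x]; first exact: probs_depth.
  have : 0 <= (`|W x| - 1) ^+ 2 by exact: sqr_ge0.
  by rewrite -exprMn (mulrC s^-1) -/(W x) -(real_normK (num_real (W x))); lra.
rewrite bernZ bernD bern_cst bernZ bern_var ?probs_depth // -sE -exprMn.
by rewrite mulVf ?gt_eqF // expr1n; lra.
Qed.

(** Centring at 2 log n instead of the mean, scaling by [q] instead of [s]. *)
Lemma depth_standardize :
  bern ps (fun x => `|Z x - W x|) <= (4 + 2 * d) / r.
Proof.
apply: le_trans (_ : bern ps (fun x => (4 + d) / r * `|W x| + d / r) <= _).
  apply: le_bern => [|x]; first exact: probs_depth.
  have -> : Z x - W x = (s / q - 1) * W x + (bmean ps - 2 * l) / q.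
    by rewrite /Z /W; field; rewrite !gt_eqF.
  rewrite (le_trans (ler_normD _ _)) // !normrM lerD ?ler_wpM2r //.
  by rewrite normfV (gtr0_norm q0) -d_def ler_wpM2l // lef_pV2 ?posrE.
rewrite bernD bernZ bern_cst.
have := ler_wpM2l (_ : 0 <= (4 + d) / r) EW.
rewrite divr_ge0 ?addr_ge0 ?(ltW r0) // => /(_ isT).
have -> : (4 + 2 * d) / r = (4 + d) / r * 1 + d / r by field; rewrite gt_eqF.
by move=> h; rewrite lerD2r.
Qed.

Lemma depth_norm_le :
  bern ps (fun x => `|Z x|) <= 1 + (4 + 2 * d) / r.
Proof.
apply: le_trans (lerD EW depth_standardize); rewrite -bernD.
apply: le_bern => [|x]; first exact: probs_depth.
by rewrite -[X in `|X| <= _](subrK (W x)) addrC ler_normD.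
Qed.

(** The constant of the error bound in [depth_gauss]. *)
Definition clt_const (B L : R) : R := 2 * stein_const B L + 4 * L.

Lemma depth_gauss (h : R -> R) (B L : R) : lipschitz_bounded B L h ->
  `|bern ps (fun x => h (Z x)) - gauss_mean h| <= clt_const B L * (1 + d) / r.
Proof.
move=> [hB hL].
have B0 : 0 <= B by exact: le_trans (hB 0).
have L0 : 0 <= L.
  by have := hL 1 0; rewrite subr0 normr1 mulr1; exact: le_trans.
have SC0 : 0 <= stein_const B L.
  by rewrite /stein_const addr_ge0 ?mulr_ge0 ?addr_ge0 ?invr_ge0 ?(ltW (gauss_gt0 _)).
have H1 := bern_gauss (probs_depth R n k) v0 (conj hB hL).
rewrite -/ps -s_def in H1.
have H2 : `|bern ps (fun x => h (Z x)) - bern ps (fun x => h (W x))| <=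
    L * ((4 + 2 * d) / r).
  rewrite -bernB (le_trans (ler_norm_bern _ _)) ?probs_depth //.
  apply: le_trans (ler_wpM2l L0 depth_standardize); rewrite -bernZ.
  by apply: le_bern => [|x]; [exact: probs_depth | exact: hL].
have H3 : stein_const B L / s <= 2 * stein_const B L / r.
  rewrite -mulrA mulrCA ler_wpM2l // -[2]invrK -invfM lef_pV2 ?posrE //; last first.
    by rewrite mulr_gt0.
  by rewrite mulrC.
rewrite -(subrK (bern ps (fun x => h (W x))) (bern ps _)) -addrA.
rewrite (le_trans (ler_normD _ _)) //.
apply: le_trans (lerD H2 (le_trans H1 H3)) _.
rewrite mulrA -mulrDl ler_wpM2r ?invr_ge0 ?(ltW r0) // /clt_const.
have : 0 <= stein_const B L * d by rewrite mulr_ge0.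
have : 0 <= L * d by rewrite mulr_ge0.
lra.
Qed.

End DepthApproximation.

(** * Convergence in distribution and Lipschitz test functions *)

Section Portmanteau.
Variable R : realType.
Implicit Types (f g : R * R -> R) (x y : R * R).

(** The l1 distance on the plane. *)
Definition dist1 x y : R := `|x.1 - y.1| + `|x.2 - y.2|.

Lemma dist1_ge0 x y : 0 <= dist1 x y.
Proof. by rewrite addr_ge0. Qed.

Lemma dist1C x y : dist1 x y = dist1 y x.
Proof. by rewrite /dist1 distrC (distrC x.2). Qed.

Lemma dist1_triangle x y z : dist1 x z <= dist1 x y + dist1 y z.
Proof.
by rewrite /dist1 addrACA lerD // ler_distD.
Qed.

(** [g] is bounded by [B] and [L]-Lipschitz for the l1 distance. *)
Definition lipschitz_bounded2 (B L : R) g : Prop :=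
  (forall x, `|g x| <= B) /\ (forall x y, `|g x - g y| <= L * dist1 x y).

(** A dense sequence of points of the plane. *)
Definition rat_point (i : nat) : R * R :=
  if @choice.unpickle (rat * rat)%type i is Some (a, b) then (ratr a, ratr b)
  else (0, 0).

Lemma rat_point_dense x (e : R) : 0 < e -> exists i, dist1 x (rat_point i) < e.
Proof.
move=> e0; have e2 : 0 < e / 2 by rewrite divr_gt0.
have near_rat (z : R) : exists a : rat, `|z - ratr a| < e / 2.
  have [|a] := @rat_in_itvoo _ z (z + e / 2); first by rewrite ltrDl.
  rewrite in_itv /= => /andP[za az]; exists a.
  by rewrite distrC gtr0_norm ?subr_gt0 // ltrBlDl.
have [a ha] := near_rat x.1; have [b hb] := near_rat x.2.
exists (choice.pickle (a, b)); rewrite /rat_point choice.pickleK /dist1 /=.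
by rewrite (splitr e) ltrD.
Qed.

Lemma continuous_dist1 f x (e : R) : continuous f -> 0 < e ->
  exists2 r : R, 0 < r & forall y, dist1 x y < r -> `|f x - f y| < e.
Proof.
move=> cf e0; have /cvgrPdist_lt /(_ e e0) := cf x.
move=> /nbhs_ballP[r /= r0 hr]; exists r => // y xy; apply: hr.
split; apply: le_lt_trans xy; rewrite /dist1; first by rewrite lerDl.
by rewrite lerDr.
Qed.

Section InfConvolution.
Variables (f : R * R -> R) (B : R).
Hypothesis cf : continuous f.
Hypothesis fB : forall x, `|f x| <= B.

(** The inf-convolution of [f] with [m] times the distance; the infimum is
    taken over a countable dense set, for the sake of measurability. *)
Definition infconv (m : R) x : R :=
  inf (range (fun i => f (rat_point i) + m * dist1 x (rat_point i))).

Lemma infconv_term_ge (m : R) x i : 0 <= m ->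
  - B <= f (rat_point i) + m * dist1 x (rat_point i).
Proof.
move=> m0; rewrite -[leLHS]addr0 lerD ?mulr_ge0 ?dist1_ge0 //.
by have := fB (rat_point i); rewrite ler_norml => /andP[].
Qed.

Lemma infconv_le_term (m : R) x i : 0 <= m ->
  infconv m x <= f (rat_point i) + m * dist1 x (rat_point i).
Proof.
move=> m0; apply: ge_inf; last by exists i.
by exists (- B) => _ [j _ <-]; exact: infconv_term_ge.
Qed.

Lemma infconv_ge (m c : R) x :
  (forall i, c <= f (rat_point i) + m * dist1 x (rat_point i)) ->
  c <= infconv m x.
Proof.
move=> h; apply: lb_le_inf; last by move=> _ [j _ <-].
by exists (f (rat_point 0) + m * dist1 x (rat_point 0)), 0%N.
Qed.

Lemma infconv_le (m : R) x : 0 <= m -> infconv m x <= f x.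
Proof.
move=> m0; apply/ler_addgt0Pr => e e0.
have e2 : 0 < e / 2 by rewrite divr_gt0.
have [r r0 hr] := continuous_dist1 x cf e2.
have m1 : 0 < m + 1 by rewrite ltr_wpDl.
have rr : 0 < Num.min r (e / 2 / (m + 1)) by rewrite lt_min r0 divr_gt0.
have [i hi] := rat_point_dense x rr.
apply: le_trans (infconv_le_term x i m0) _.
move: hi; rewrite lt_min => /andP[/hr h1 h2].
have : m * dist1 x (rat_point i) <= e / 2.
  apply: le_trans (_ : (m + 1) * dist1 x (rat_point i) <= _).
    by rewrite ler_wpM2r ?dist1_ge0 // lerDl.
  by rewrite mulrC -ler_pdivlMr // ltW.
move: h1; rewrite ltr_norml => /andP[]; lra.
Qed.

Lemma infconv_lipschitz (m : R) : 0 <= m -> lipschitz_bounded2 B m (infconv m).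
Proof.
move=> m0; split=> [x|].
  rewrite ler_norml; apply/andP; split.
    by apply: infconv_ge => i; exact: infconv_term_ge.
  by rewrite (le_trans (infconv_le x m0)) // (le_trans (ler_norm _)).
have main x y : infconv m x - m * dist1 x y <= infconv m y.
  apply: infconv_ge => i; rewrite lerBlDr -addrA -mulrDr.
  apply: le_trans (infconv_le_term x i m0) _.
  by rewrite lerD2l ler_wpM2l // addrC dist1_triangle.
move=> x y; rewrite ler_norml; have := main x y; have := main y x.
by rewrite (dist1C y x) => h1 h2; apply/andP; split; lra.
Qed.

Lemma infconv_cvg x : infconv n%:R x @[n --> \oo] --> f x.
Proof.
apply/cvgrPdist_le => e e0; have [r r0 hr] := continuous_dist1 x cf e0.
have B0 : 0 <= B by exact: le_trans (fB x).
near=> n.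
have m0 : 0 <= n%:R :> R by [].
rewrite ger0_norm ?subr_ge0 ?infconv_le // lerBlDr -lerBlDl.
apply: infconv_ge => i; have [xi|xi] := ltP (dist1 x (rat_point i)) r.
  have := hr _ xi; rewrite ltr_norml => /andP[_ h].
  have : 0 <= n%:R * dist1 x (rat_point i) by rewrite mulr_ge0 ?dist1_ge0.
  by move: h; lra.
have : 2 * B <= n%:R * dist1 x (rat_point i).
  apply: le_trans (_ : n%:R * r <= _); last by rewrite ler_wpM2l.
  rewrite -ler_pdivrMr //; near: n; exact: nbhs_infty_ger.
have := fB x; have := fB (rat_point i); rewrite !ler_norml.
by move=> /andP[? ?] /andP[? ?]; lra.
Unshelve. all: by end_near. Qed.

Lemma measurable_infconv d (T : measurableType d) (X Y : T -> R) (m : R) :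
  0 <= m -> measurable_fun setT X -> measurable_fun setT Y ->
  measurable_fun setT (fun w => infconv m (X w, Y w)).
Proof.
move=> m0 mX mY.
pose h (i : nat) (w : T) :=
  f (rat_point i) + m * dist1 (X w, Y w) (rat_point i).
rewrite (_ : (fun w => _) = (fun w => infs (h ^~ w) 0)).
  apply: measurable_fun_infs.
    by move=> w _; exists (- B) => _ [j _ <-]; exact: infconv_term_ge.
  move=> i; apply: measurable_funD => //; apply: measurable_funM => //.
  by apply: measurable_funD; apply: measurableT_comp => //=;
    apply: measurable_funB.
apply/funext => w; rewrite /infconv /infs; congr (inf _).
by apply/seteqP; split => [_ [i _ <-]|_ [i _ <-]]; exists i.
Qed.

Lemma measurable_continuous2 d (T : measurableType d) (X Y : T -> R) :
  measurable_fun setT X -> measurable_fun setT Y ->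
  measurable_fun setT (fun w => f (X w, Y w)).
Proof.
move=> mX mY; apply: (measurable_fun_cvg
  (h := fun n w => infconv n%:R (X w, Y w))) => [n|w _].
  exact: measurable_infconv.
exact: infconv_cvg.
Qed.

End InfConvolution.

Lemma integrable_bounded d (T : measurableType d) (P : probability T R)
  (X : T -> R) (B : R) : measurable_fun setT X -> (forall w, `|X w| <= B) ->
  P.-integrable setT (EFin \o X).
Proof.
move=> mX XB; apply: measurable_bounded_integrable => //.
  by rewrite (le_lt_trans (probability_le1 _ _)) // ltry.
exists B; split; first exact: num_real.
by move=> y By w _; rewrite /= (le_trans (XB w)) // ltW.
Qed.

(** Convergence of the expectations of bounded Lipschitz functions implies
    convergence of the expectations of bounded continuous functions: a bounded
    continuous function is the increasing limit of its inf-convolutions. *)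
Lemma portmanteau d (T : measurableType d) (P : probability T R) (X Y : T -> R)
  (E : nat -> (R * R -> R) -> R) (f : R * R -> R) (B : R) :
  measurable_fun setT X -> measurable_fun setT Y ->
  (forall n g1 g2, (forall x, g1 x <= g2 x) -> E n g1 <= E n g2) ->
  (forall n g, E n (fun x => - g x) = - E n g) ->
  (forall A L g, lipschitz_bounded2 A L g ->
    E n g @[n --> \oo] --> \int[P]_w g (X w, Y w)) ->
  continuous f -> (forall x, `|f x| <= B) ->
  E n f @[n --> \oo] --> \int[P]_w f (X w, Y w).
Proof.
move=> mX mY Ele EN Elip.
have lower (g : R * R -> R) : continuous g -> (forall x, `|g x| <= B) ->
    forall e, 0 < e -> \forall n \near \oo, \int[P]_w g (X w, Y w) - e <= E n g.
  move=> cg gB e e0; have e2 : 0 < e / 2 by rewrite divr_gt0.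
  have mgm m := measurable_infconv gB (ler0n R m) mX mY.
  have mg := measurable_continuous2 cg gB mX mY.
  have gmB m x : `|infconv g m%:R x| <= B.
    by have [] := infconv_lipschitz cg gB (ler0n R m).
  have ig := integrable_bounded P mg (fun w => gB _).
  have cvgint : \int[P]_w infconv g m%:R (X w, Y w) @[m --> \oo] -->
      \int[P]_w g (X w, Y w).
    apply: fine_cvg; rewrite fineK; last exact: integrable_fin_num.
    have mE (h : T -> R) : measurable_fun setT h ->
        measurable_fun setT (EFin \o h) by move=> ?; exact/measurable_EFinP.
    have H1 : {ae P, forall w, setT w ->
        (fun m => (infconv g m%:R (X w, Y w))%:E) @ \oo --> (g (X w, Y w))%:E}.
      apply: aeW => w _; apply: cvg_EFin; first exact: nearW.
      exact: infconv_cvg cg gB (X w, Y w).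
    have H2 : P.-integrable setT (cst B%:E).
      exact: (integrable_bounded P (measurable_cst B) (fun=> lexx `|B|)).
    have H3 : {ae P, forall w m, setT w ->
        (`|(infconv g m%:R (X w, Y w))%:E| <= cst B%:E w)%E}.
      by apply: aeW => w m _; rewrite /= lee_fin.
    have [_ _] := dominated_convergence measurableT
      (fun m => mE _ (mgm m)) (mE _ mg) H1 H2 H3.
    exact.
  have /cvgrPdist_lt /(_ _ e2) [m _ /(_ m (leqnn m)) /= hm] := cvgint.
  have /cvgrPdist_lt /(_ _ e2) := Elip _ _ _ (infconv_lipschitz cg gB (ler0n R m)).
  apply: filterS => n hn.
  have := Ele n _ _ (fun x => infconv_le cg gB x (ler0n R m)).
  by move: hm hn; rewrite !ltr_norml => /andP[? ?] /andP[? ?]; lra.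
move=> cf fB; apply/cvgrPdist_le => e e0.
have cNf : continuous (fun x => - f x) by move=> x; apply: cvgN; exact: cf.
have NfB x : `|- f x| <= B by rewrite normrN.
have h1 := lower f cf fB e e0; have h2 := lower _ cNf NfB e e0.
near=> n.
have : \int[P]_w f (X w, Y w) - e <= E n f by near: n.
have : \int[P]_w (- f (X w, Y w)) - e <= E n (fun x => - f x) by near: n.
rewrite EN.
have -> : \int[P]_w (- f (X w, Y w)) = - \int[P]_w f (X w, Y w).
  under eq_Rintegral do rewrite -mulN1r.
  rewrite RintegralZl // ?mulN1r //.
  exact: integrable_bounded (measurable_continuous2 cf fB mX mY) (fun w => fB _).
by move=> h h'; rewrite ler_norml; apply/andP; split; lra.
Unshelve. all: by end_near. Qed.

End Portmanteau.

(** * Integrals against the limit laws *)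

Section LimitLaws.
Variables (R : realType) (d : measure_display) (T : measurableType d).
Variables (P : probability T R) (N xi : {RV P >-> R}).
Hypothesis lawN : has_law N (normal_prob 0 1).

Lemma measurable_RV (X : {RV P >-> R}) : measurable_fun setT (X : T -> R).
Proof. exact: measurable_funP. Qed.

(** Independence of [N] and of the event [D] factors integrals over [D]. *)
Lemma ge0_integral_indep (D : set T) (h : R -> R) : measurable D ->
  (forall A, measurable A -> P (N @^-1` A `&` D) = (P (N @^-1` A) * P D)%E) ->
  measurable_fun setT h -> (forall x, 0 <= h x) ->
  (\int[P]_(w in D) (h (N w))%:E =
   P D * \int[normal_prob 0 1]_x (h x)%:E)%E.
Proof.
move=> mD indep mh h0.
have mN : measurable_fun setT (N : T -> measurableTypeR R) := measurable_RV N.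
have mhN : measurable_fun setT (fun w => (h (N w))%:E).
  by apply/measurable_EFinP; exact: measurableT_comp.
(* The image by [N] of the restriction of [P] to [D] is a multiple of the
   normal law. *)
pose PD := mrestr P mD.
have PDfin : P D \is a fin_num by exact: fin_num_measure.
transitivity (\int[PD]_(w in D) (h (N w))%:E)%E.
  by apply: eq_measure_integral => A mA AD; rewrite /PD /= /mrestr setIidl.
transitivity (\int[PD]_w (h (N w))%:E)%E.
  rewrite [RHS](ge0_negligible_integral (measurableC mD) measurableT) //.
  - by rewrite setTD setCK.
  - by move=> x _; rewrite lee_fin.
  - by rewrite /PD /= /mrestr setICl measure0.
rewrite -[LHS](ge0_integral_pushforward mN PD (f := fun x => (h x)%:E)
  measurableT) //; last 2 first.
- exact/measurable_EFinP.
- by move=> x _; rewrite lee_fin.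
have k0 : 0 <= fine (P D) by rewrite fine_ge0.
rewrite -[P D]fineK // -[(fine (P D))%:E]/((NngNum k0)%:num%:E).
rewrite -ge0_integral_mscale //; last 2 first.
- exact/measurable_EFinP.
- by move=> x _; rewrite lee_fin.
apply: eq_measure_integral => A mA _.
transitivity (P (N @^-1` A `&` D)); first by [].
rewrite indep //.
transitivity ((fine (P D))%:E * normal_prob 0 1 A)%E; last by [].
by rewrite fineK // muleC -lawN.
Qed.

Lemma Rintegral_indep (D : set T) (h : R -> R) (B : R) : measurable D ->
  (forall A, measurable A -> P (N @^-1` A `&` D) = (P (N @^-1` A) * P D)%E) ->
  continuous h -> (forall x, `|h x| <= B) ->
  \int[P]_(w in D) h (N w) = fine (P D) * gauss_mean h.
Proof.
move=> mD indep ch hB.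
have mh : measurable_fun setT h by exact: continuous_measurable_fun.
have mhN : measurable_fun setT (fun w => h (N w)).
  exact: measurableT_comp mh (measurable_RV N).
have B00 : 0 <= B by exact: le_trans (hB 0).
(* Adding [B] makes the integrand nonnegative. *)
have B0 x : 0 <= h x + B.
  by have := hB x; rewrite ler_norml => /andP[? _]; lra.
have mhB : measurable_fun setT (fun x => h x + B) by exact: measurable_funD.
have := ge0_integral_indep mD indep mhB B0.
move=> /(congr1 fine); rewrite fineM ?fin_num_measure //; last first.
  apply: integrable_fin_num => //.
  apply: (integrable_bounded (normal_prob 0 1) (B := B + B)) => // x.
  by rewrite (le_trans (ler_normD _ _)) // lerD // ger0_norm.
rewrite -!/(Rintegral _ _ _).
have intD : P.-integrable D (EFin \o (fun w => h (N w))).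
  by apply: integrableS (integrable_bounded P mhN (fun w => hB _)).
have inth := integrable_bounded (normal_prob 0 1) mh hB.
rewrite RintegralD //; last first.
  apply: (@integrableS _ _ _ P setT) => //.
  exact: (integrable_bounded P (measurable_cst B) (fun=> lexx `|B|)).
rewrite RintegralD //; last first.
  exact: (integrable_bounded _ (measurable_cst B) (fun=> lexx `|B|)).
have EB : \int[normal_prob 0 1]_x B = B.
  rewrite Rintegral_cst // -[RHS]mulr1; congr (_ * _).
  by rewrite -[RHS]/(fine 1%E); congr fine; exact: probability_setT.
rewrite EB Rintegral_cst // mulrDr.
by rewrite [B * _]mulrC => /addIr.
Qed.

Lemma Rintegral_normal (h : R -> R) (B : R) :
  continuous h -> (forall x, `|h x| <= B) ->
  \int[P]_w h (N w) = gauss_mean h.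
Proof.
move=> ch hB; rewrite (Rintegral_indep measurableT _ ch hB).
  by rewrite probability_setT mul1r.
by move=> A mA; rewrite setIT probability_setT mule1.
Qed.

Hypothesis law_xi : has_law xi (uniform_prob (@ltr01 R)).
Hypothesis indepNxi : independent_RV N xi.

Lemma uniform_prob_itv (a b : R) : 0 <= a -> a <= b -> b <= 1 ->
  P (xi @^-1` `[a, b[) = (b - a)%:E.
Proof.
move=> a0 ab b1; transitivity (uniform_prob (@ltr01 R) `[a, b[).
  exact: (law_xi (measurable_itv `[a, b[)).
rewrite /uniform_prob.
rewrite (eq_integral (fun=> 1%E)); last first.
  move=> x; rewrite inE /= in_itv /= => /andP[ax xb].
  by rewrite /uniform_pdf (le_trans a0 ax) (le_trans (ltW xb) b1) /= subr0 invr1.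
rewrite integral_cst //= mul1e lebesgue_measure_itv /= lte_fin -EFinB.
by move: ab; rewrite le_eqVlt => /predU1P[->|->//]; rewrite ltxx subrr.
Qed.

Section Grid.
Variables (g : R * R -> R) (A L : R) (n : nat).
Hypothesis gAL : lipschitz_bounded2 A L g.
Hypothesis n0 : (0 < n)%N.

Lemma lipschitz2_continuous : continuous g.
Proof.
have [_ gL] := gAL => x; apply/cvgrPdist_le => e e0.
have L1 : 0 < `|L| + 1 by rewrite ltr_wpDl.
have r0 : 0 < e / (`|L| + 1) / 2 by rewrite !divr_gt0.
near=> y; have [h1 h2] : ball x (e / (`|L| + 1) / 2) y.
  by near: y; exact: (nbhsx_ballx x _ r0).
apply: le_trans (gL x y) _.
apply: le_trans (_ : (`|L| + 1) * dist1 x y <= _).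
  by rewrite ler_wpM2r ?dist1_ge0 // (le_trans (ler_norm L)) // lerDl.
rewrite -ler_pdivlMl // mulrC (splitr (e / _)) lerD //; exact: ltW.
Unshelve. all: by end_near. Qed.

Lemma lipschitz2_slice c : lipschitz_bounded A L (fun x => g (x, c)).
Proof.
have [gA gL] := gAL; split=> [x|x y]; first exact: gA.
by have := gL (x, c) (y, c); rewrite /dist1 /= subrr normr0 addr0.
Qed.

Let F w := g (N w, xi w).
Let gm (k : nat) := gauss_mean (fun x => g (x, k%:R / n%:R)).
Let U (m : nat) := xi @^-1` `[0, m%:R / n%:R[.

Let mU m : measurable (U m).
Proof. by rewrite -[U m]setTI; exact: measurable_RV. Qed.

Let iF D : measurable D -> P.-integrable D (EFin \o F).
Proof.
move=> mD; apply: (@integrableS _ _ _ P setT) => //.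
have [gA _] := gAL; apply: (integrable_bounded P (B := A)) => [|w]; last exact: gA.
by apply: (measurable_continuous2 lipschitz2_continuous gA); exact: measurable_RV.
Qed.

Let grid_step m : (m <= n)%N ->
  `|\int[P]_(w in U m) F w - n%:R^-1 * \sum_(k <- iota 1 m) gm k| <=
  m%:R * (n%:R^-1 * (L / n%:R)).
Proof.
have n0' : 0 < n%:R :> R by rewrite ltr0n.
elim: m => [_|m IH mn].
  rewrite big_nil mulr0 mul0r subr0.
  rewrite (_ : U 0 = set0) ?Rintegral_set0 ?normr0 //.
  by rewrite /U mul0r set_itv_ge ?preimage_set0 // bnd_simp ltxx.
pose I := `[m%:R / n%:R, m.+1%:R / n%:R[%classic : set R.
pose D := xi @^-1` I.
have mD : measurable D.
  by rewrite -[D]setTI; apply: measurable_RV => //; exact: measurable_itv.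
have mSn : m%:R / n%:R <= m.+1%:R / n%:R :> R.
  by rewrite ler_wpM2r ?invr_ge0 ?ler_nat // ltW.
have UD : U m.+1 = U m `|` D.
  rewrite /U /D /I -preimage_setU; congr (_ @^-1` _).
  rewrite -itv_bndbnd_setU //= bnd_simp //.
have PD : P D = (n%:R^-1)%:E.
  rewrite /D /I uniform_prob_itv ?divr_ge0 //.
    by rewrite -mulrBl -natr1 addrAC subrr add0r mul1r.
  by rewrite ler_pdivrMr // mul1r ler_nat.
have sAL := lipschitz2_slice (m.+1%:R / n%:R).
have cs := lipschitz_continuous sAL.2.
have ED : \int[P]_(w in D) g (N w, m.+1%:R / n%:R) = n%:R^-1 * gm m.+1.
  rewrite (Rintegral_indep mD _ cs sAL.1); first by rewrite PD.
  by move=> B mB; apply: indepNxi => //; exact: measurable_itv.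
rewrite UD Rintegral_setU //; last 2 first.
- by apply: iF; exact: measurableU.
- apply/disj_setPS => w []; rewrite /U /D /I /= !in_itv /= => /andP[_ h1] /andP[h2 _].
  by move: (lt_le_trans h1 h2); rewrite ltxx.
have -> : \sum_(k <- iota 1 m.+1) gm k = \sum_(k <- iota 1 m) gm k + gm m.+1.
  by rewrite -[X in iota 1 X]addn1 iotaD big_cat big_seq1 /= add1n.
rewrite mulrDr -ED opprD addrACA.
have -> : m.+1%:R * (n%:R^-1 * (L / n%:R)) =
    m%:R * (n%:R^-1 * (L / n%:R)) + n%:R^-1 * (L / n%:R) :> R.
  by rewrite -natr1 mulrDl mul1r.
rewrite (le_trans (ler_normD _ _)) // lerD ?IH 1?ltnW //.
have iG : P.-integrable D (EFin \o (fun w => g (N w, m.+1%:R / n%:R))).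
  apply: (@integrableS _ _ _ P setT) => //.
  apply: (integrable_bounded P (B := A)) => [|w]; last exact: sAL.1.
  exact: measurableT_comp (continuous_measurable_fun cs) (measurable_RV N).
rewrite -RintegralB //; last exact: iF.
apply: le_trans (le_normr_Rintegral _ _) _ => //.
  by have := integrableB mD (iF mD) iG.
have iC : P.-integrable D (EFin \o (fun=> L / n%:R)).
  apply: (@integrableS _ _ _ P setT) => //.
  exact: (integrable_bounded P (measurable_cst _) (fun=> lexx `|L / n%:R|)).
apply: le_trans (_ : \int[P]_(w in D) (L / n%:R) <= _); last first.
  rewrite Rintegral_cst // -[X in _ <= X * _]/(fine (n%:R^-1)%:E) -PD.
  by rewrite mulrC.
apply: le_Rintegral => //.
  rewrite (_ : EFin \o _ = abse \o (EFin \o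
    (fun w => F w - g (N w, m.+1%:R / n%:R)))); last by apply/funext.
  apply/integrable_abse; exact: (integrableB mD (iF mD) iG).
move=> w; rewrite /D /I /= in_itv /= => /andP[w1 w2].
have [_ gL] := gAL; apply: le_trans (gL _ _) _.
have L0 : 0 <= L.
  have := gL (1, 0) (0, 0); rewrite /dist1 /= !subr0 normr1 normr0 addr0 mulr1.
  exact: le_trans.
rewrite ler_wpM2l // /dist1 /= subrr normr0 add0r ltr0_norm ?subr_lt0 //.
rewrite opprB lerBlDr -lerBlDl; apply: le_trans w1.
by rewrite -natr1 mulrDl mul1r addrK.
Qed.

(** Replacing [xi] by the grid point above it costs at most the mesh. *)
Lemma grid_approx :
  `|\int[P]_w g (N w, xi w) - n%:R^-1 * \sum_(k <- iota 1 n) gm k| <= L / n%:R.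
Proof.
have n0' : n%:R != 0 :> R by rewrite pnatr_eq0 -lt0n.
have := grid_step (leqnn n); rewrite mulrA mulfV // mul1r.
have -> : \int[P]_(w in U n) F w = \int[P]_w F w.
  rewrite /Rintegral; congr fine.
  rewrite [RHS](negligible_integral (measurableC (mU n)) measurableT) //.
  - by rewrite setTD setCK.
  - exact: iF.
  - transitivity (1 - P (U n))%E; first exact: (probability_setC P (mU n)).
    by rewrite /U mulfV // uniform_prob_itv // subr0 subee.
exact.
Qed.

End Grid.

End LimitLaws.

(** * The three limit theorems *)

Section LimitTheorems.
Variable R : realType.
Local Notation L n := (ln (n%:R : R)).

Lemma cvg_ln : ln (n%:R : R) @[n --> \oo] --> +oo.
Proof.
apply/cvgryPge => A; near=> n.
have h : expR A <= n%:R by near: n; exact: nbhs_infty_ger.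
by rewrite -ler_expR lnK // posrE (lt_le_trans (expR_gt0 A)).
Unshelve. all: by end_near. Qed.

Lemma near_ln_ge (A : R) : \forall n \near \oo, A <= ln (n%:R : R).
Proof. by have /cvgryPge := cvg_ln; exact. Qed.

Lemma near_gt0 : \forall n \near \oo, (0 < n)%N.
Proof. exact: nbhs_infty_gt. Qed.

Lemma cvg_inv_sqrt_ln : (Num.sqrt (ln (n%:R : R)))^-1 @[n --> \oo] --> (0 : R).
Proof.
apply/cvgrPdist_le => e e0; near=> n.
have h : e ^- 2 <= ln (n%:R : R) by near: n; exact: near_ln_ge.
have h0 : 0 < ln (n%:R : R) by apply: lt_le_trans h; rewrite invr_gt0 exprn_gt0.
rewrite sub0r normrN ger0_norm ?invr_ge0 ?sqrtr_ge0 //.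
rewrite invf_ple ?posrE ?sqrtr_gt0 //.
rewrite -[leLHS](@ger0_norm R) ?invr_ge0 ?(ltW e0) // -sqrtr_sqr.
by rewrite ler_sqrt ?(ltW h0) // exprVn.
Unshelve. all: by end_near. Qed.

(** Convergence in distribution of statistics of the list of keys, through
    averages over the orderings of 1, ..., n. *)
Lemma cvg_in_distribution_perm (y : nat -> seq nat -> R * R)
  (d : measure_display) (T : measurableType d) (P : probability T R)
  (X Y : {RV P >-> R}) :
  (forall A C g, lipschitz_bounded2 A C g ->
    avg (iota 1 n) (fun t => g (y n t)) @[n --> \oo] -->
      \int[P]_w g (X w, Y w)) ->
  cvg_in_distribution (fun n => uniform_perm n R)
    (fun n s => y n (perm_keys s)) P (fun w => (X w, Y w)).
Proof.
move=> h f cf bf.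
have [B fB] : exists B, forall x, `|f x| <= B.
  have [M [_ hM]] := bf; exists (`|M| + 1) => x.
  by apply: hM => //; rewrite ltr_pwDr // ler_norm.
have mX := measurable_RV X; have mY := measurable_RV Y.
have mf := measurable_continuous2 cf fB mX mY.
have -> : ('E_P[f \o (fun w => (X w, Y w))] = (\int[P]_w f (X w, Y w))%:E)%E.
  rewrite unlock /Rintegral fineK //; apply: integrable_fin_num => //.
  exact: (integrable_bounded P mf (fun w => fB _)).
have E n : ('E_(uniform_perm n R)[f \o (fun s => y n (perm_keys s))] =
    (avg (iota 1 n) (fun t => f (y n t)))%:E)%E.
  exact: (expectation_perm_keys n (fun t => f (y n t))).
under eq_cvg do rewrite E.
apply: cvg_EFin; first exact: nearW.
apply: (portmanteau (E := fun n g => avg (iota 1 n) (fun t => g (y n t)))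
  mX mY _ _ h cf fB).
- by move=> n g1 g2 g12; apply: le_in_avg => t _; exact: g12.
- by move=> n g; rewrite avgN.
Qed.

(** The standard deviation of k D_k is at least k sqrt(log n) / 2. *)
Lemma stddev_depth_ge n k : (1 <= k <= n)%N -> 8 <= L n ->
  k%:R * (Num.sqrt (L n) / 2) <=
  stddev (uniform_perm n R) (fun s => k%:R * node_depth k s).
Proof.
move=> kn l8; rewrite /stddev.
pose D (s : seq nat) : R := (depth k (bst s))%:R.
have E1 : ('E_(uniform_perm n R)[(fun s => k%:R * node_depth k s)%R] =
    (k%:R * avg (iota 1 n) D)%:E)%E.
  by rewrite -avgZ; exact: (expectation_perm_keys n (fun s => k%:R * D s)).
have -> : fine ('V_(uniform_perm n R)[(fun s => k%:R * node_depth k s)%R])%E =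
    k%:R ^+ 2 * avg (iota 1 n) (fun s => (D s - avg (iota 1 n) D) ^+ 2).
  rewrite /variance unlock E1 /= -[RHS]avgZ.
  pose F s := (k%:R * D s - k%:R * avg (iota 1 n) D) *
    (k%:R * D s - k%:R * avg (iota 1 n) D).
  transitivity (avg (iota 1 n) F).
    exact: (congr1 fine (expectation_perm_keys n F)).
  by apply: eq_avg => s; rewrite /F; ring.
rewrite sqrtrM ?sqr_ge0 // sqrtr_sqr ger0_norm // ler_wpM2l //.
have l0 : 0 <= L n by lra.
have -> : Num.sqrt (L n) / 2 = Num.sqrt (L n / 4).
  rewrite sqrtrM // -(@ger0_norm R 2^-1) // -sqrtr_sqr; congr (_ * Num.sqrt _).
  by rewrite expr2; field.
rewrite ler_sqrt; last by apply: avg_ge0 => s; exact: sqr_ge0.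
apply: le_trans (variance_depth_ge R kn).
have mono m : (0 < m)%N -> L m <= L m.+1.
  by move=> m0; rewrite ler_ln ?posrE ?ltr0n // ler_nat.
have := mono k; have := mono (n - k).+1 isT.
have := bvar_invs_ge R k; have := bvar_invs_ge R (n - k).+1.
have := harmonic_ge R k; have := harmonic_ge R (n - k).+1.
have := ln_mul_ge R kn; have /andP[k1 _] := kn.
by move=> h1 h2 h3 h4 h5 h6 /(_ k1) h7; lra.
Qed.

(** The difference between W_k and k D_k is negligible with respect to the
    standard deviation of k D_k. *)
Lemma mean_wdepth_littleo (k : nat -> nat) :
  (forall n, (0 < n)%N -> (1 <= k n <= n)%N) ->
  (k n)%:R * Num.sqrt (L n) / n%:R @[n --> \oo] --> (+oo : set_system R) ->
  (fun n => fine 'E_(uniform_perm n R)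
              [(fun s => `|node_wdepth (k n) s - (k n)%:R * node_depth (k n) s|)%R]%E : R^o)
  =o_\oo
  (fun n => stddev (uniform_perm n R)
              (fun s => (k n)%:R * node_depth (k n) s) : R^o).
Proof.
move=> hk hlim; apply/eqoP => e e0.
have l8 := near_ln_ge 8.
have /cvgryPge /(_ (4 / e)) hbig := hlim.
near=> n.
have n0 : (0 < n)%N by near: n; exact: near_gt0.
have n0' : 0 < n%:R :> R by rewrite ltr0n.
have kn := hk n n0.
have ln8 : 8 <= L n by near: n.
have hb : 4 / e <= (k n)%:R * Num.sqrt (L n) / n%:R by near: n.
rewrite (expectation_perm_keys n (fun s => `|(wdepth (k n) (bst s))%:R -
  (k n)%:R * (depth (k n) (bst s))%:R|)) /=.
rewrite ger0_norm; last by apply: avg_ge0.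
apply: le_trans (avg_wdepth_sub R kn) _.
have sd0 := stddev_depth_ge kn ln8.
apply: le_trans (_ : e * ((k n)%:R * (Num.sqrt (L n) / 2)) <= _); last first.
  by rewrite ler_wpM2l ?(ltW e0) // (le_trans sd0) // ler_norm.
move: hb; rewrite ler_pdivlMr // mulrAC ler_pdivrMr //.
by lra.
Unshelve. all: by end_near. Qed.

Let q n : R := Num.sqrt (2 * L n).
Let r n : R := Num.sqrt (L n).
Let dev n k : R := `|bmean (depth_probs R n k) - 2 * L n|.
Let z n k t : R := ((late_depth n k t)%:R - 2 * L n) / q n.

Section Scales.
Variables (n k : nat).
Hypothesis kn : (1 <= k <= n)%N.
Hypothesis l8 : 8 <= L n.

Let l0 : 0 < L n. Proof. by apply: lt_le_trans l8. Qed.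
Lemma r_gt0 : 0 < r n. Proof. by rewrite sqrtr_gt0. Qed.
Lemma q_gt0 : 0 < q n. Proof. by rewrite sqrtr_gt0 mulr_gt0. Qed.
Lemma r_sqr : r n ^+ 2 = L n. Proof. by rewrite sqr_sqrtr // ltW. Qed.
Lemma q_sqr : q n ^+ 2 = 2 * L n.
Proof. by rewrite sqr_sqrtr // mulr_ge0 // ltW. Qed.

Lemma r_ge1 : 1 <= r n.
Proof.
have : 1 ^+ 2 <= r n ^+ 2 by rewrite r_sqr expr1n; have := l8; lra.
by rewrite ler_sqr ?nnegrE ?(ltW r_gt0).
Qed.

Lemma r_le_q : r n <= q n.
Proof.
have : r n ^+ 2 <= q n ^+ 2 by rewrite r_sqr q_sqr; have := l0; lra.
by rewrite ler_sqr ?nnegrE ?(ltW r_gt0) ?(ltW q_gt0).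
Qed.

Lemma q_le_2r : q n <= 2 * r n.
Proof.
have : q n ^+ 2 <= (2 * r n) ^+ 2.
  by rewrite exprMn r_sqr q_sqr; have := l0; lra.
by rewrite ler_sqr ?nnegrE ?(ltW q_gt0) // mulr_ge0 // ltW // r_gt0.
Qed.

Lemma bern_depth_norm :
  bern (depth_probs R n k) (fun x => `|(x%:R - 2 * L n) / q n|) <=
  1 + (4 + 2 * dev n k) / r n.
Proof.
exact: (depth_norm_le kn (erefl _) l8 (erefl _) (erefl _) (erefl _) (erefl _)).
Qed.

Lemma bern_depth_gauss h A C : lipschitz_bounded A C h ->
  `|bern (depth_probs R n k) (fun x => h ((x%:R - 2 * L n) / q n)) -
    gauss_mean h| <= clt_const A C * (1 + dev n k) / r n.
Proof.
exact: (depth_gauss kn (erefl _) l8 (erefl _) (erefl _) (erefl _) (erefl _)).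
Qed.

End Scales.

Section FixedKey.
Variables (alpha : R) (g : R * R -> R) (A C : R).
Hypothesis alpha0 : 0 < alpha.
Hypothesis gAC : lipschitz_bounded2 A C g.

Lemma lipschitz2_ge0 : 0 <= C.
Proof.
have [_ gC] := gAC; have := gC (1, 0) (0, 0).
by rewrite /dist1 /= !subr0 normr1 normr0 addr0 mulr1; exact: le_trans.
Qed.

Lemma lipschitz_diag : lipschitz_bounded A (2 * C) (fun x => g (x, x)).
Proof.
have [gA gC] := gAC; split=> // x y.
by have := gC (x, x) (y, y); rewrite /dist1 /= mulrDr -mulrA mulr_natl mulr2n.
Qed.

Let yb n k (t : seq nat) : R * R :=
  (((depth k (bst t))%:R - 2 * L n) / q n,
   ((wdepth k (bst t))%:R - 2 * alpha * n%:R * L n) / (alpha * n%:R * q n)).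

(** The error for a bounded Lipschitz test function in the limit theorem for a
    given key [k]. *)
Lemma depth_wdepth_bound n k : (1 <= k <= n)%N -> 8 <= L n ->
  `|avg (iota 1 n) (fun t => g (yb n k t)) - gauss_mean (fun x => g (x, x))| <=
  (C * (2 + 4 / alpha) + clt_const A (2 * C) * (1 + dev n k)) / r n +
  C * (7 + 2 * dev n k) / alpha * (r n * `|k%:R / n%:R - alpha|).
Proof.
move=> kn l8; have C0 := lipschitz2_ge0.
have r0 := r_gt0 l8; have q0 := q_gt0 l8.
have n0 : 0 < n%:R :> R by rewrite ltr0n; case/andP: kn; exact: leq_trans.
set rho := `|_ - alpha|; have rho0 : 0 <= rho by exact: normr_ge0.
have H1 := bern_depth_gauss kn l8 lipschitz_diag.
rewrite -avg_late_depth // in H1.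
pose e1 t : R := `|(depth k (bst t))%:R - (late_depth n k t)%:R|.
pose e2 t : R := `|(wdepth k (bst t))%:R - k%:R * (depth k (bst t))%:R|.
have rn : (q n)^-1 <= (r n)^-1 by rewrite lef_pV2 ?posrE // r_le_q.
have D1 t : `|(yb n k t).1 - z n k t| <= e1 t / r n.
  rewrite /yb /z /= -mulrBl opprB addrA subrK normrM normfV (gtr0_norm q0).
  by rewrite ler_wpM2l.
have kna : k%:R / n%:R <= 1 :> R.
  by rewrite ler_pdivrMr // mul1r ler_nat; case/andP: kn.
have D2 t : `|(yb n k t).2 - z n k t| <=
    e2 t / (alpha * n%:R * r n) + e1 t / (alpha * r n) +
    rho / alpha * `|z n k t| + 2 * r n * rho / alpha.
  (* W_k is replaced by k D_k, then D_k by the depth of k inserted last, then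
     k by alpha n. *)
  have -> : (yb n k t).2 - z n k t =
    ((wdepth k (bst t))%:R - k%:R * (depth k (bst t))%:R) / (alpha * n%:R * q n) +
    (k%:R / n%:R) / alpha * ((yb n k t).1 - z n k t) +
    (k%:R / n%:R - alpha) / alpha * z n k t +
    q n * (k%:R / n%:R - alpha) / alpha.
    rewrite /yb /z /=; set a := (depth _ _)%:R; set b := (wdepth _ _)%:R.
    set c := (late_depth _ _ _)%:R.
    have -> : 2 * alpha * n%:R * L n = alpha * n%:R * q n ^+ 2.
      by rewrite q_sqr //; ring.
    rewrite -q_sqr //; field; rewrite !gt_eqF //.
  rewrite (le_trans (ler_normD _ _)) // lerD //; last first.
    rewrite normrM normfV (gtr0_norm alpha0) ler_wpM2r ?invr_ge0 ?(ltW alpha0) //.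
    by rewrite normrM (gtr0_norm q0) ler_wpM2r // q_le_2r.
  rewrite (le_trans (ler_normD _ _)) // lerD //; last first.
    by rewrite !normrM normfV (gtr0_norm alpha0).
  rewrite (le_trans (ler_normD _ _)) // lerD //.
    rewrite normrM normfV; apply: ler_wpM2l => //.
    have an : 0 < alpha * n%:R by rewrite mulr_gt0.
    rewrite gtr0_norm ?mulr_gt0 // lef_pV2 ?posrE ?mulr_gt0 //.
    by rewrite ler_wpM2l ?(ltW an) // r_le_q.
  rewrite normrM ger0_norm ?divr_ge0 ?(ltW alpha0) ?(ltW n0) //.
  rewrite [e1 t / _](_ : _ = alpha^-1 * (e1 t / r n)); last first.
    by field; rewrite !gt_eqF.
  apply: ler_pM => //; first by rewrite divr_ge0 ?divr_ge0 ?(ltW alpha0) ?(ltW n0).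
  by rewrite ler_pdivrMr // mulVf ?gt_eqF.
have E1 : avg (iota 1 n) e1 <= 2 := avg_late_depth_sub R kn.
have E2 : avg (iota 1 n) e2 <= 2 * n%:R := avg_wdepth_sub R kn.
have E3 : avg (iota 1 n) (fun t => `|z n k t|) <= 1 + (4 + 2 * dev n k) / r n.
  rewrite (avg_late_depth (fun x => `|(x%:R - 2 * L n) / q n|) kn).
  exact: bern_depth_norm.
have H2 : `|avg (iota 1 n) (fun t => g (yb n k t)) -
    avg (iota 1 n) (fun t => g (z n k t, z n k t))| <=
    C * (2 / r n + 4 / (alpha * r n) +
      rho / alpha * (1 + (4 + 2 * dev n k) / r n) + 2 * r n * rho / alpha).
  rewrite -avgB (le_trans (ler_norm_avg _ _)) //.
  apply: le_trans (_ : avg (iota 1 n) (fun t => C * ((r n)^-1 * e1 t +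
    (alpha * n%:R * r n)^-1 * e2 t + (alpha * r n)^-1 * e1 t +
    rho / alpha * `|z n k t| + 2 * r n * rho / alpha)) <= _).
    apply: le_in_avg => t _; have [_ gC] := gAC; apply: le_trans (gC _ _) _.
    rewrite ler_wpM2l // /dist1 /=; have := D1 t; have := D2 t.
    by rewrite ![_^-1 * _]mulrC /=; lra.
  rewrite avgZ ler_wpM2l // !avgD !avgZ avg_cst ?iota_uniq //.
  rewrite lerD2r lerD //; last by rewrite ler_wpM2l // divr_ge0 // ltW.
  have -> : 4 / (alpha * r n) = (alpha * n%:R * r n)^-1 * (2 * n%:R) +
      (alpha * r n)^-1 * 2 by field; rewrite !gt_eqF.
  rewrite [2 / r n]mulrC -addrA; apply: lerD.
    by rewrite ler_wpM2l // invr_ge0 ltW.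
  have ar : 0 < alpha * r n by rewrite mulr_gt0.
  apply: lerD; rewrite ler_wpM2l // invr_ge0 ltW // mulr_gt0 // mulr_gt0 //.
rewrite -(subrK (avg (iota 1 n) (fun t => g (z n k t, z n k t))) (avg _ _)) -addrA.
rewrite (le_trans (ler_normD _ _)) // (le_trans (lerD H2 H1)) //.
have d0 : 0 <= dev n k by exact: normr_ge0.
have r1 := r_ge1 l8.
have H3 : rho / alpha * (1 + (4 + 2 * dev n k) / r n) <=
    (5 + 2 * dev n k) / alpha * (r n * rho).
  have -> : (5 + 2 * dev n k) / alpha * (r n * rho) =
    rho / alpha * (r n * (5 + 2 * dev n k)) by field; rewrite gt_eqF.
  rewrite ler_wpM2l ?divr_ge0 ?(ltW alpha0) //.
  have : (4 + 2 * dev n k) / r n <= r n * (4 + 2 * dev n k).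
    rewrite ler_pdivrMr // mulrAC -[leLHS]mul1r ler_wpM2r ?addr_ge0 ?mulr_ge0 //.
    by rewrite -(mulr1 1) ler_pM.
  lra.
have := ler_wpM2l C0 H3.
have -> : (C * (2 + 4 / alpha) + clt_const A (2 * C) * (1 + dev n k)) / r n =
  C * (2 / r n + 4 / (alpha * r n)) + clt_const A (2 * C) * (1 + dev n k) / r n.
  by field; rewrite !gt_eqF.
have -> : C * (7 + 2 * dev n k) / alpha * (r n * rho) =
  C * ((5 + 2 * dev n k) / alpha * (r n * rho)) + C * (2 * r n * rho / alpha).
  by field; rewrite gt_eqF.
lra.
Qed.

End FixedKey.

Lemma clt_const_ge0 (A C : R) : 0 <= A -> 0 <= C -> 0 <= clt_const A C.
Proof.
move=> A0 C0; rewrite /clt_const /stein_const.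
by rewrite addr_ge0 ?mulr_ge0 ?addr_ge0 ?mulr_ge0 ?addr_ge0 ?invr_ge0
  ?(ltW (gauss_gt0 _)).
Qed.

(** If k/n is close to [alpha], the mean is 2 log n up to a bounded term. *)
Lemma dev_bounded (alpha : R) n k : 0 < alpha < 1 -> (1 <= k <= n)%N ->
  `|k%:R / n%:R - alpha| <= alpha / 2 ->
  `|k%:R / n%:R - alpha| <= (1 - alpha) / 2 ->
  dev n k <= 2 + `|ln (alpha / 2)| + `|ln ((1 - alpha) / 2)|.
Proof.
move=> /andP[a0 a1] kn; have /andP[k1 kn'] := kn.
have n1 : (0 < n)%N by exact: leq_trans kn'.
have n0 : 0 < n%:R :> R by rewrite ltr0n.
have a2 : 0 < alpha / 2 by rewrite divr_gt0.
have b2 : 0 < (1 - alpha) / 2 by rewrite divr_gt0 // subr_gt0.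
rewrite ler_norml => /andP[h1 _]; rewrite ler_norml => /andP[_ h2].
have lk : ln (alpha / 2) + L n <= L k.
  rewrite -lnM ?posrE // ler_ln ?posrE ?mulr_gt0 ?ltr0n //.
  by rewrite -ler_pdivlMr //; lra.
have lnk : ln ((1 - alpha) / 2) + L n <= L (n - k).+1.
  rewrite -lnM ?posrE // ler_ln ?posrE ?mulr_gt0 ?subr_gt0 ?ltr0n //.
  apply: le_trans (_ : (n - k)%:R <= _); last by rewrite ler_nat.
  rewrite natrB // -ler_pdivlMr //.
  have -> : (n%:R - k%:R) / n%:R = 1 - k%:R / n%:R :> R.
    by field; rewrite gt_eqF.
  by lra.
have := bmean_depth_ge R kn; have := bmean_depth_le R kn => h3 h4.
have := ler_norm (- ln (alpha / 2)); have := ler_norm (- ln ((1 - alpha) / 2)).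
have := normr_ge0 (ln (alpha / 2)); have := normr_ge0 (ln ((1 - alpha) / 2)).
rewrite !normrN => g1 g2 g3 g4.
by rewrite /dev /= ler_norml; apply/andP; split; lra.
Qed.

Lemma cvg_depth_wdepth (alpha : R) (k : nat -> nat) :
  0 < alpha < 1 ->
  (forall n, (0 < n)%N -> (1 <= k n <= n)%N) ->
  (fun n => `|(k n)%:R / n%:R - alpha| : R^o)
    =o_\oo (fun n => (Num.sqrt (L n))^-1 : R^o) ->
  forall (d : measure_display) (T : measurableType d)
    (P : probability T R) (N : {RV P >-> R}),
  has_law N (normal_prob 0 1) ->
  cvg_in_distribution
    (fun n => uniform_perm n R)
    (fun n s =>
       ((node_depth (k n) s - 2 * L n) / Num.sqrt (2 * L n),
        (node_wdepth (k n) s - 2 * alpha * n%:R * L n)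
          / (alpha * n%:R * Num.sqrt (2 * L n))))
    P (fun w => (N w, N w)).
Proof.
move=> a01 hk /eqoP hlim d T P N lawN; have /andP[a0 a1] := a01.
apply: (cvg_in_distribution_perm (y := fun n t =>
  (((depth (k n) (bst t))%:R - 2 * L n) / q n,
   ((wdepth (k n) (bst t))%:R - 2 * alpha * n%:R * L n) / (alpha * n%:R * q n)))).
move=> A C g gAC; have C0 := lipschitz2_ge0 gAC.
have A0 : 0 <= A by case: gAC => gA _; exact: le_trans (gA (0, 0)).
have [diagA diagC] := lipschitz_diag gAC.
rewrite (Rintegral_normal lawN (lipschitz_continuous diagC) diagA).
apply/cvgrPdist_le => e e0.
pose d0 := 2 + `|ln (alpha / 2)| + `|ln ((1 - alpha) / 2)|.
have d00 : 0 <= d0 by rewrite !addr_ge0.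
pose K1 := C * (2 + 4 / alpha) + clt_const A (2 * C) * (1 + d0).
pose K2 := C * (7 + 2 * d0) / alpha.
have cc0 : 0 <= clt_const A (2 * C) by rewrite clt_const_ge0 // mulr_ge0.
have K10 : 0 <= K1.
  apply: addr_ge0; apply: mulr_ge0 => //; apply: addr_ge0 => //.
  by rewrite divr_ge0 // ltW.
have K20 : 0 <= K2.
  apply: divr_ge0; last exact: ltW.
  by apply: mulr_ge0 => //; apply: addr_ge0 => //; exact: mulr_ge0.
pose e1 := e / 2 / (K1 + 1); pose e2 := e / 2 / (K2 + 1).
have K11 : 0 < K1 + 1 by rewrite ltr_wpDl.
have K21 : 0 < K2 + 1 by rewrite ltr_wpDl.
have e10 : 0 < e1 by rewrite !divr_gt0.
have e20 : 0 < e2 by rewrite !divr_gt0.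
have small (x : R) : 0 < x -> \forall n \near \oo, (r n)^-1 <= x.
  move=> x0; have /cvgrPdist_le /(_ x x0) := cvg_inv_sqrt_ln.
  apply: filterS => n; rewrite sub0r normrN; apply: le_trans; exact: ler_norm.
have a2 : 0 < alpha / 2 by rewrite divr_gt0.
have b2 : 0 < (1 - alpha) / 2 by rewrite divr_gt0 // subr_gt0.
have l8 := near_ln_ge 8; have sm1 := small _ e10.
have sma := small _ a2; have smb := small _ b2.
have lim1 := hlim 1 ltr01; have lim2 := hlim _ e20.
near=> n.
have n0 : (0 < n)%N by near: n; exact: near_gt0.
have kn := hk n n0.
have ln8 : 8 <= L n by near: n.
have r0 := r_gt0 ln8.
have ri0 : 0 < (r n)^-1 by rewrite invr_gt0.
have h1 : `|(`|(k n)%:R / n%:R - alpha|)| <= 1 * `|(r n)^-1| by near: n.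
have h2 : `|(`|(k n)%:R / n%:R - alpha|)| <= e2 * `|(r n)^-1| by near: n.
rewrite normr_id (gtr0_norm ri0) mul1r in h1.
rewrite normr_id (gtr0_norm ri0) in h2.
have ra : (r n)^-1 <= alpha / 2 by near: n.
have rb : (r n)^-1 <= (1 - alpha) / 2 by near: n.
have re : (r n)^-1 <= e1 by near: n.
have dn := dev_bounded a01 kn (le_trans h1 ra) (le_trans h1 rb).
rewrite distrC; apply: le_trans (depth_wdepth_bound a0 gAC kn ln8) _.
apply: le_trans (_ : K1 * (r n)^-1 +
  K2 * (r n * `|(k n)%:R / n%:R - alpha|) <= _).
  apply: lerD; apply: ler_wpM2r.
  - exact: ltW.
  - by rewrite lerD2l ler_wpM2l // lerD2l.
  - by rewrite mulr_ge0 // ltW.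
  - rewrite ler_wpM2r ?invr_ge0 ?(ltW a0) // ler_wpM2l // lerD2l ler_wpM2l //.
have hr : r n * `|(k n)%:R / n%:R - alpha| <= e2.
  by rewrite mulrC -ler_pdivlMr.
have := ler_wpM2l K10 re; have := ler_wpM2l K20 hr.
have : K1 * e1 <= e / 2.
  by rewrite /e1 mulrCA ler_piMr ?divr_ge0 ?(ltW e0) // ler_pdivrMr // mul1r lerDl.
have : K2 * e2 <= e / 2.
  by rewrite /e2 mulrCA ler_piMr ?divr_ge0 ?(ltW e0) // ler_pdivrMr // mul1r lerDl.
lra.
Unshelve. all: by end_near. Qed.

Section LastKey.
Variables (g : R * R -> R) (A C : R).
Hypothesis gAC : lipschitz_bounded2 A C g.

Let yc n (t : seq nat) : R * R :=
  (((depth (last 0%N t) (bst t))%:R - 2 * L n) / q n,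
   (wdepth (last 0%N t) (bst t))%:R / (2 * n%:R * L n)).

(** Conditionally on the last key being [k]. *)
Lemma last_depth_wdepth_slice n k : (1 <= k <= n)%N -> 8 <= L n ->
  `|avg (rem k (iota 1 n)) (fun t => g (yc n (rcons t k))) -
    gauss_mean (fun x => g (x, k%:R / n%:R))| <=
  (6 * C + clt_const A C) * (1 + dev n k) / r n.
Proof.
move=> kn l8; have C0 := lipschitz2_ge0 gAC.
have r0 := r_gt0 l8; have q0 := q_gt0 l8; have r1 := r_ge1 l8.
have l0 : 0 < L n by lra.
have n0 : 0 < n%:R :> R by rewrite ltr0n; case/andP: kn; exact: leq_trans.
have d0 : 0 <= dev n k by exact: normr_ge0.
have ul : uniq (rem k (iota 1 n)) by rewrite rem_uniq // iota_uniq.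
have H1 := bern_depth_gauss kn l8 (lipschitz2_slice gAC (k%:R / n%:R)).
rewrite -(avg_late_depth_rem _ kn) in H1.
pose e2 t : R := `|(wdepth k (bst (rcons t k)))%:R - k%:R * (late_depth n k t)%:R|.
have E2 : avg (rem k (iota 1 n)) e2 <= 2 * n%:R := avg_wdepth_last_sub R kn.
have E3 : avg (rem k (iota 1 n)) (fun t => `|z n k t|) <=
    1 + (4 + 2 * dev n k) / r n.
  rewrite (avg_late_depth_rem (fun x => `|(x%:R - 2 * L n) / q n|) kn).
  exact: bern_depth_norm.
have kna : k%:R / n%:R <= 1 :> R.
  by rewrite ler_pdivrMr // mul1r ler_nat; case/andP: kn.
have D t : perm_eq t (rem k (iota 1 n)) ->
    dist1 (yc n (rcons t k)) (z n k t, k%:R / n%:R) <=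
    (2 * n%:R * L n)^-1 * e2 t + (r n)^-1 * `|z n k t|.
  move=> tl; rewrite /dist1 /yc last_rcons (depth_bst_last kn tl) /=.
  rewrite -/(z n k t) subrr normr0 add0r.
  have -> : (wdepth k (bst (rcons t k)))%:R / (2 * n%:R * L n) - k%:R / n%:R =
    (2 * n%:R * L n)^-1 * ((wdepth k (bst (rcons t k)))%:R -
      k%:R * (late_depth n k t)%:R) + k%:R / n%:R * ((q n)^-1 * z n k t).
    rewrite /z; set c := (late_depth _ _ _)%:R; set b := (wdepth _ _)%:R.
    have -> : L n = q n ^+ 2 / 2 by rewrite q_sqr //; field.
    by field; rewrite !gt_eqF.
  rewrite (le_trans (ler_normD _ _)) // lerD //.
    by rewrite normrM gtr0_norm // invr_gt0 !mulr_gt0.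
  rewrite normrM ger0_norm ?divr_ge0 ?(ltW n0) //.
  rewrite -[leRHS]mul1r; apply: ler_pM => //.
  rewrite normrM gtr0_norm ?invr_gt0 // ler_wpM2r // lef_pV2 ?posrE //.
  exact: r_le_q.
have H2 : `|avg (rem k (iota 1 n)) (fun t => g (yc n (rcons t k))) -
    avg (rem k (iota 1 n)) (fun t => g (z n k t, k%:R / n%:R))| <=
    C * ((6 + 2 * dev n k) / r n).
  rewrite -avgB (le_trans (ler_norm_avg _ _)) //.
  apply: le_trans (_ : avg (rem k (iota 1 n)) (fun t =>
    C * ((2 * n%:R * L n)^-1 * e2 t + (r n)^-1 * `|z n k t|)) <= _).
    apply: le_in_avg => t tl; have [_ gC] := gAC; apply: le_trans (gC _ _) _.
    by rewrite ler_wpM2l // D.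
  rewrite avgZ ler_wpM2l // avgD !avgZ.
  have B1 : (2 * n%:R * L n)^-1 * avg (rem k (iota 1 n)) e2 <= (r n)^-1.
    apply: le_trans (_ : (2 * n%:R * L n)^-1 * (2 * n%:R) <= _).
      by rewrite ler_wpM2l // invr_ge0 !mulr_ge0 // ltW.
    have -> : (2 * n%:R * L n)^-1 * (2 * n%:R) = (L n)^-1.
      by field; rewrite !gt_eqF.
    rewrite lef_pV2 ?posrE // -r_sqr // expr2 -[leLHS]mulr1.
    by rewrite ler_wpM2l // ltW.
  have B2 : (r n)^-1 * avg (rem k (iota 1 n)) (fun t => `|z n k t|) <=
      (5 + 2 * dev n k) / r n.
    rewrite mulrC ler_wpM2r ?invr_ge0 ?(ltW r0) //; apply: le_trans E3 _.
    have : (4 + 2 * dev n k) / r n <= 4 + 2 * dev n k.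
      by rewrite ler_pdivrMr // ler_peMr ?addr_ge0 ?mulr_ge0.
    lra.
  apply: le_trans (lerD B1 B2) _.
  by rewrite -{1}[(r n)^-1]mul1r -mulrDl ler_wpM2r ?invr_ge0 ?(ltW r0) //; lra.
rewrite -(subrK (avg (rem k (iota 1 n)) (fun t => g (z n k t, k%:R / n%:R)))
  (avg _ _)) -addrA.
rewrite (le_trans (ler_normD _ _)) // (le_trans (lerD H2 H1)) //.
rewrite mulrA -mulrDl ler_wpM2r ?invr_ge0 ?(ltW r0) //.
have : 0 <= C * dev n k by rewrite mulr_ge0.
lra.
Qed.

Lemma last_depth_wdepth_bound n : (0 < n)%N -> 8 <= L n ->
  `|avg (iota 1 n) (fun t => g (yc n t)) -
    n%:R^-1 * \sum_(k <- iota 1 n) gauss_mean (fun x => g (x, k%:R / n%:R))| <=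
  7 * (6 * C + clt_const A C) / r n.
Proof.
move=> n0 l8; have n0' : 0 < n%:R :> R by rewrite ltr0n.
have C0 := lipschitz2_ge0 gAC.
have A0 : 0 <= A by case: gAC => gA _; exact: le_trans (gA (0, 0)).
have K0 : 0 <= 6 * C + clt_const A C by rewrite addr_ge0 ?mulr_ge0 ?clt_const_ge0.
have r0 := r_gt0 l8.
rewrite avg_rcons ?iota_uniq //; last by case: (n) n0.
rewrite size_iota mulrC -mulrBr normrM gtr0_norm ?invr_gt0 // -sumrB.
rewrite mulrC ler_pdivrMr //.
apply: le_trans (ler_norm_sum _ _ _) _.
apply: le_trans (_ : \sum_(k <- iota 1 n)
  ((6 * C + clt_const A C) / r n * (1 + dev n k)) <= _).
  rewrite big_seq [leRHS]big_seq; apply: ler_sum => k; rewrite mem_iota1 => kn.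
  by rewrite mulrAC last_depth_wdepth_slice.
rewrite -mulr_sumr big_split /= sum_cst_seq size_iota mulr1.
set c := 6 * C + clt_const A C in K0 *.
have -> : 7 * c / r n * n%:R = c / r n * (7 * n%:R) by ring.
apply: ler_wpM2l; first by rewrite divr_ge0 // ltW.
have := avg_bmean_depth R n0; rewrite -/dev; lra.
Qed.

End LastKey.

Lemma cvg_last_depth_wdepth (d : measure_display) (T : measurableType d)
  (P : probability T R) (N xi : {RV P >-> R}) :
  has_law N (normal_prob 0 1) ->
  has_law xi (uniform_prob (@ltr01 R)) ->
  independent_RV N xi ->
  cvg_in_distribution
    (fun n => uniform_perm n R)
    (fun n s =>
       ((last_depth s - 2 * L n) / Num.sqrt (2 * L n),
        last_wdepth s / (2 * n%:R * L n)))
    P (fun w => (N w, xi w)).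
Proof.
move=> lawN lawxi indep.
apply: (cvg_in_distribution_perm (y := fun n t =>
  (((depth (last 0%N t) (bst t))%:R - 2 * L n) / q n,
   (wdepth (last 0%N t) (bst t))%:R / (2 * n%:R * L n)))).
move=> A C g gAC; have C0 := lipschitz2_ge0 gAC.
have A0 : 0 <= A by case: gAC => gA _; exact: le_trans (gA (0, 0)).
apply/cvgrPdist_le => e e0; have e2 : 0 < e / 2 by rewrite divr_gt0.
pose K := 7 * (6 * C + clt_const A C).
have K0 : 0 <= K.
  by apply: mulr_ge0 => //; apply: addr_ge0; [exact: mulr_ge0|exact: clt_const_ge0].
have K10 : 0 < K + 1 by rewrite ltr_wpDl.
have l8 := near_ln_ge 8.
have sm : \forall n \near \oo, (r n)^-1 <= e / 2 / (K + 1).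
  have e3 : 0 < e / 2 / (K + 1) by rewrite divr_gt0.
  have /cvgrPdist_le /(_ _ e3) := cvg_inv_sqrt_ln.
  by apply: filterS => n; rewrite sub0r normrN; apply: le_trans; exact: ler_norm.
near=> n.
have n0 : (0 < n)%N by near: n; exact: near_gt0.
have n0' : 0 < n%:R :> R by rewrite ltr0n.
have ln8 : 8 <= L n by near: n.
have re : (r n)^-1 <= e / 2 / (K + 1) by near: n.
have Cn : C / n%:R <= e / 2.
  rewrite ler_pdivrMr // mulrC -ler_pdivrMr //.
  by near: n; exact: nbhs_infty_ger.
have H1 := last_depth_wdepth_bound gAC n0 ln8; have H2 := grid_approx lawN lawxi indep gAC n0.
apply: le_trans (ler_distD (n%:R^-1 * \sum_(k <- iota 1 n)
  gauss_mean (fun x => g (x, k%:R / n%:R))) _ _) _.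
rewrite (splitr e) lerD //; first exact: le_trans H2 Cn.
rewrite distrC; apply: le_trans H1 _.
apply: le_trans (ler_wpM2l K0 re) _.
by rewrite mulrCA ler_piMr ?(ltW e2) // ler_pdivrMr // mul1r lerDl.
Unshelve. all: by end_near. Qed.

End LimitTheorems.

Theorem theorem1 (R : realType) :
  [/\ forall k : nat -> nat,
        (forall n, (0 < n)%N -> (1 <= k n <= n)%N) ->
        (k n)%:R * Num.sqrt (ln n%:R) / n%:R @[n --> \oo] --> (+oo : set_system R) ->
        (fun n => fine 'E_(uniform_perm n R)
                    [(fun s => `|node_wdepth (k n) s - (k n)%:R * node_depth (k n) s|)%R]%E : R^o)
        =o_\oo
        (fun n => stddev (uniform_perm n R)
                    (fun s => (k n)%:R * node_depth (k n) s) : R^o),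
      forall (alpha : R) (k : nat -> nat),
        0 < alpha < 1 ->
        (forall n, (0 < n)%N -> (1 <= k n <= n)%N) ->
        (fun n => `|(k n)%:R / n%:R - alpha| : R^o)
          =o_\oo (fun n => (Num.sqrt (ln n%:R))^-1 : R^o) ->
        forall (d : measure_display) (T : measurableType d)
          (P : probability T R) (N : {RV P >-> R}),
        has_law N (normal_prob 0 1) ->
        cvg_in_distribution
          (fun n => uniform_perm n R)
          (fun n s =>
             ((node_depth (k n) s - 2 * ln n%:R) / Num.sqrt (2 * ln n%:R),
              (node_wdepth (k n) s - 2 * alpha * n%:R * ln n%:R)
                / (alpha * n%:R * Num.sqrt (2 * ln n%:R))))
          P (fun w => (N w, N w))
    & forall (d : measure_display) (T : measurableType d)
        (P : probability T R) (N xi : {RV P >-> R}),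
        has_law N (normal_prob 0 1) ->
        has_law xi (uniform_prob (@ltr01 R)) ->
        independent_RV N xi ->
        cvg_in_distribution
          (fun n => uniform_perm n R)
          (fun n s =>
             ((last_depth s - 2 * ln n%:R) / Num.sqrt (2 * ln n%:R),
              last_wdepth s / (2 * n%:R * ln n%:R)))
          P (fun w => (N w, xi w))].
Proof.
split.
- exact: mean_wdepth_littleo.
- exact: cvg_depth_wdepth.
- exact: cvg_last_depth_wdepth.
Qed.
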